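(* Let $l, g, \mu > 0$ be real constants, let $\xi \colon \mathbb{R} \to \mathbb{R}$ be a twice differentiable function whose second derivative $\ddot\xi$ is Lipschitz, and let $t_0 \in \mathbb{R}$. Consider the system $$ \dot q = p, \qquad \dot p = \frac{\ddot\xi(t)}{l}\sin q - \frac{\mu}{l}\left|\ddot\xi(t)\cos q - l p^2 + g \sin q\right|\frac{p}{|p|} - \frac{g}{l}\cos q, $$ with solutions understood in the sense of the associated differential inclusion $(\dot q,\dot p)\in\Phi(q,p,t)$. Then there exist $q_0 \in [0,\pi]$ and $p_0 \in \mathbb{R}$ such that the solution $(q(t),p(t))$ with initial conditions $q(t_0)=q_0$, $p(t_0)=p_0$ satisfies $q(t)\in[0,\pi]$ for all $t>t_0$.
   Context: The system describes an inverted planar pendulum of length $l$ in a gravitational field with acceleration $g$, with Coulomb dry friction coefficient $\mu$, whose pivot moves along a horizontal line according to the given law $\xi(t)$; $q$ is the angle between the horizontal line and the rod ($q=0$ and $q=\pi$ are the horizontal positions). The right-hand side is $2\pi$-periodic in $q$; here $q$ is regarded as a real-valued coordinate. The right-hand side $f(q,p,t)$ of the system is undefined (discontinuous) on the plane $M=\{p=0\}$. The associated set-valued map $\Phi$ is defined as follows: $\Phi(q,p,t)\subset\mathbb{R}^2$ is the smallest closed convex set containing all limit values of $f(q^*,p^*,t)$ as $(q^*,p^* )\to(q,p)$ with $p^*\neq 0$. Explicitly, $\Phi(q,p,t)=\{f(q,p,t)\}$ for $p\ne 0$, and $$ \Phi(q,0,t)=\{0\}\times\left[a-b,\;a+b\right],\quad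 a=\frac{\ddot\xi(t)}{l}\sin q-\frac{g}{l}\cos q,\quad b=\frac{\mu}{l}\left|\ddot\xi(t)\cos q+g\sin q\right|. $$ A solution is an absolutely continuous function $t\mapsto(q(t),p(t))$ on an interval or segment $I$ such that $(\dot q(t),\dot p(t))\in\Phi(q(t),p(t),t)$ for almost every $t\in I$. For every initial condition at $t_0$, a solution exists on $[t_0,\infty)$ and is unique forward in time, which gives meaning to ''the solution''. *)

(* Defs.v *)
From HB Require Import structures.
From mathcomp Require Import all_boot all_order all_algebra.
From mathcomp Require Import all_classical all_reals all_analysis.

Set Implicit Arguments.
Unset Strict Implicit.
Unset Printing Implicit Defensive.

Import Order.TTheory GRing.Theory Num.Theory.
Import numFieldNormedType.Exports.

Local Open Scope classical_set_scope.
Local Open Scope ring_scope.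

Definition abs_continuous (R : realType) (V : normedModType R)
    (a b : R) (x : R -> V) : Prop :=
  forall e : R, 0 < e -> exists2 d : R, 0 < d &
    forall (n : nat) (u v : 'I_n -> R),
      (forall i, a <= u i /\ u i <= v i /\ v i <= b) ->
      trivIset setT (fun i => `]u i, v i[%classic) ->
      \sum_(i < n) (v i - u i) < d ->
      \sum_(i < n) `|x (v i) - x (u i)| < e.

Definition closed_convex_hull (R : realType) (V : normedModType R)
    (A : set V) : set V :=
  smallest (fun C => closed C /\ convex_set C) A.

(* Limit values of [f y] as [y] tends to [x] with [y] in [D]; the values of [f]
   outside [D] play no role. *)
Definition limit_values (T U : topologicalType) (f : T -> U) (D : set T)
    (x : T) : set U :=
  cluster (f @ within D (nbhs x)).

(* Absolute continuity is required on the compact subsegments of [I], the usual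
   convention when [I] is unbounded. The derivative is the two-sided one; at an
   endpoint of [I] it would involve values of [x] outside [I], but endpoints
   are negligible. *)
Definition is_solution (R : realType) (V : normedModType R)
    (Phi : V -> R -> set V) (I : interval R) (x : R -> V) : Prop :=
  (forall a b : R, a \in I -> b \in I -> abs_continuous a b x) /\
  {ae @lebesgue_measure R, forall t : R, t \in I ->
    exists2 v : V, is_derive t 1 x v & Phi (x t) t v}.

(* States are pairs [(q, p)]; [R^o] carries the [R]-module structure. At
   [p = 0] the library convention [0 / 0 = 0] gives an irrelevant value. *)
Definition pendulum_rhs (R : realType) (l g mu : R) (xi : R -> R)
    (x : R^o * R^o) (t : R) : R^o * R^o :=
  let q : R := x.1 in
  let p : R := x.2 in
  (p,
   xi^`(2)%classic t / l * sin q
   - mu / l * `|xi^`(2)%classic t * cos q - l * p ^+ 2 + g * sin q| * (p / `|p|)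
   - g / l * cos q).

Definition pendulum_Phi (R : realType) (l g mu : R) (xi : R -> R)
    (x : R^o * R^o) (t : R) : set (R^o * R^o) :=
  closed_convex_hull
    (limit_values (fun y => pendulum_rhs l g mu xi y t)
                  [set y | y.2 != 0] x).

(* Main.v *)
Require Import Defs.
From HB Require Import structures.
From mathcomp Require Import all_boot all_order all_algebra.
From mathcomp Require Import all_classical all_reals all_analysis.
From mathcomp Require Import ring lra.

Set Implicit Arguments.
Unset Strict Implicit.
Unset Printing Implicit Defensive.

Import Order.TTheory GRing.Theory Num.Theory.
Import numFieldNormedType.Exports.

Local Open Scope classical_set_scope.
Local Open Scope ring_scope.

(** Start with [p = 0]. At [q = 0] the drift of [p] is [- g / l], at [q = pi] it
    is [g / l]. If outside [[0, pi]] the drift is frozen at these values and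
    friction is switched off, a motion that leaves on one side never comes back,
    and the sets of initial angles that leave on the left and on the right are
    open and disjoint. They contain [0] and [pi], so by connectedness some angle
    stays. To avoid proving continuous dependence for the inclusion, this
    argument is run on a semi-implicit Euler scheme with a regularized sign,
    where continuity is evident. The viable solution is the limit of viable
    discrete trajectories along an ultrafilter. The limit of the speeds is
    locally Lipschitz; where it does not vanish it is differentiable with the
    required derivative, and almost everywhere on its zero set its derivative
    is [0] by the Lebesgue density theorem. Uniqueness is Gronwall's inequality:
    dry friction is monotone in [p], so the right-hand side is one-sided
    Lipschitz. *)

(** The regularization must meet two opposite demands: each discrete step has to depend continuously
    on the angle, yet the jump of the friction has to reappear in the limit. The slope of the
    regularized sign therefore grows like [n + 1] while the step is [1 / (n + 1)^2], so that
    [(n + 1) * mesh n] tends to 0 and the mixture of old and new speeds in the implicit friction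
    leaves no trace. Slopes of the discrete motions are bounded uniformly in [n] on bounded times,
    which lets convergence at one time control all nearby times. Two points of the limit need an
    argument. The sign of a nonzero speed is recovered only for [0 < q < pi]; this is enough,
    because a differentiable [q] confined to [[0, pi]] has zero speed at the ends. On the zero set
    of [p], a vanishing derivative solves the inclusion only if the drift does not exceed the
    friction; this is read off from the increments of [p], whose slope differs from the drift by at
    most the friction. *)

(** * Derivatives through increments, and induction on a segment *)

Lemma is_deriveP (R : realType) (V : normedModType R) (f : R -> V) (t : R)
    (v : V) :
  is_derive t 1 f v <->
  forall e : R, 0 < e -> exists2 d : R, 0 < d &
    forall h : R, `|h| < d -> `|f (t + h) - f t - h *: v| <= e * `|h|.
Proof.
have key (h : R) : h != 0 ->
    `|f (t + h) - f t - h *: v| =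
    `|h| * `|v - h^-1 *: ((f \o shift t) (h *: 1) - f t)|.
  move=> h0; rewrite -normrZ scalerBr scalerA divff// scale1r distrC /=.
  by rewrite /shift /= [h *: 1]mulr1 [h + t]addrC.
split=> [[df dv] e e0|H].
  have : h^-1 *: ((f \o shift t) (h *: 1) - f t) @[h --> 0^'] --> v.
    by rewrite -dv; exact: df.
  move/cvgrPdist_le => /(_ e e0); rewrite near_withinE.
  move=> /nbhs_ballP[d /= d0 Hd]; exists d => // h hd.
  have [->|h0] := eqVneq h 0.
    by rewrite addr0 subrr scale0r subr0 !normr0 mulr0.
  rewrite key// mulrC ler_wpM2r//; apply: Hd => //.
  by rewrite /ball /= sub0r normrN.
have cv : h^-1 *: ((f \o shift t) (h *: 1) - f t) @[h --> 0^'] --> v.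
  apply/cvgrPdist_le => e e0; rewrite near_withinE.
  have [d d0 Hd] := H e e0.
  apply/nbhs_ballP; exists d => //= h; rewrite /ball /= sub0r normrN => hd h0.
  have := Hd h hd; rewrite key// mulrC ler_pM2r//.
  by rewrite normr_gt0.
by split; [apply/cvg_ex; exists v | exact: cvg_lim].
Qed.

Lemma is_derive_pairP (R : realType) (x : R -> R^o * R^o) (t v1 v2 : R) :
  is_derive t 1 x (v1, v2) <->
  is_derive t 1 (fun s => (x s).1 : R) v1 /\
  is_derive t 1 (fun s => (x s).2 : R) v2.
Proof.
rewrite !is_deriveP; split=> [H|[H1 H2] e e0].
  split=> e e0; have [d d0 Hd] := H e e0; exists d => // h /Hd;
    apply: le_trans; rewrite prod_normE /= le_max lexx ?orbT//.
have [d1 d10 Hd1] := H1 e e0; have [d2 d20 Hd2] := H2 e e0.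
exists (Num.min d1 d2); first by rewrite lt_min d10.
move=> h; rewrite lt_min => /andP[h1 h2].
by rewrite prod_normE /= ge_max Hd1// Hd2.
Qed.

(* Cousin's lemma, in the form of an induction principle on a segment. *)
Lemma segment_ind (R : realType) (a b : R) (P : R -> Prop) :
  a <= b -> P a ->
  (forall t, a <= t <= b -> exists2 d : R, 0 < d &
     forall u v, a <= u -> v <= b -> t - d < u -> u <= t -> t <= v ->
       v < t + d -> P u -> P v) ->
  P b.
Proof.
move=> ab Pa step.
pose E := [set t | a <= t <= b /\ P t].
have Ea : E a by rewrite /E /= lexx ab.
have hE : has_sup E by split; [exists a | exists b => t [/andP[]]].
have aS : a <= sup E by apply: ub_le_sup => //; case: hE.
have Sb : sup E <= b by apply: ge_sup; [exists a | move=> t [/andP[]]].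
have /step[d d0 Hd] : a <= sup E <= b by rewrite aS Sb.
have [u [/andP[au ub] Pu] uS] := sup_adherent d0 hE.
have uleS : u <= sup E.
  by apply: ub_le_sup; [case: hE | split=> //; apply/andP].
have Pv v : sup E <= v -> v <= b -> v < sup E + d -> P v.
  by move=> Sv vb vd; apply: (Hd u v).
have [Sltb|bS] := ltP (sup E) b; last by apply: Pv => //; lra.
(* A point beyond [sup E] that still lies in the window around it and in the segment: [P] would hold
   there, against the choice of the supremum. *)
pose v := Num.min b (sup E + d / 2).
have vb : v <= b by rewrite /v ge_min lexx.
have Sv : sup E < v by rewrite /v lt_min Sltb/= ltrDl divr_gt0.
have vd : v < sup E + d by rewrite /v gt_min orbC; apply/orP; left; lra.
suff : v <= sup E by rewrite leNgt Sv.
apply: ub_le_sup; first by case: hE.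
by split; [rewrite vb andbT; lra | apply: Pv => //; lra].
Qed.

(** * Absolutely continuous functions *)

(* The null set where the derivative is not controlled is covered by an open
   set of small measure; the intervals of a Cousin partition tagged there
   contribute little by absolute continuity, and they are collected in [s]. *)
Lemma abs_continuous_nonincreasing (R : realType) (a b : R) (w : R -> R^o) :
  a <= b -> abs_continuous a b w ->
  {ae @lebesgue_measure R, forall t, a <= t <= b ->
     exists2 v : R, is_derive t 1 w v & v <= 0} ->
  w b <= w a.
Proof.
move=> ab acw [D [mD D0 HD]].
pose mu := @lebesgue_measure R.
apply/ler_addgt0Pr => e e0.
(* The total error is [eps * (b - a)] from the slopes plus [eps] from absolute continuity, that is
   [e]. *)
pose eps := e / (b - a + 1).
have ba1 : 0 < b - a + 1 by rewrite ltr_wpDl// subr_ge0.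
have eps0 : 0 < eps by rewrite divr_gt0.
have [d d0 Hd] := acw eps eps0.
have [U [oU DU muU]] : exists U : set R, [/\ open U, D `<=` U & (mu U < d%:E)%E].
  have Doo : (lebesgue_measure D < +oo)%E by rewrite D0 ltry.
  have [U [oU DU muU]] := lebesgue_regularity_outer mD Doo d0.
  exists U; split => //; have mU := measurable_realfun.open_measurable oU.
  apply: le_lt_trans muU.
  rewrite -[X in (mu X <= _)%E](setDUK DU).
  apply: (le_trans (measureU2 _ mD (measurableD mU mD))).
  by have /= -> := D0; rewrite add0e.
have mU := measurable_realfun.open_measurable oU.
(* New intervals are put at the head, so [s] runs from right to left. The third condition charges
   their total length to the part of [U] already swept, hence keeps it below [d]. *)
pose P t := exists s : seq (R * R),
  [/\ {in s, forall i, a <= i.1 /\ i.1 <= i.2 /\ i.2 <= t},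
      pairwise (fun i j => j.2 <= i.1) s,
      ((\sum_(i <- s) (i.2 - i.1))%:E <= mu (U `&` `]a, t]))%E &
      w t - w a <= eps * (t - a) + \sum_(i <- s) `|w i.2 - w i.1|].
have : P b.
  apply: (segment_ind ab).
    by exists [::]; split => //; rewrite ?big_nil ?measure_ge0// !subrr mulr0 addr0.
  move=> t /andP[tgea tleb].
  have [tD|tND] := pselect (D t).
    have /nbhs_ballP[r /= r0 Hr] : nbhs t U by apply: open_nbhs_nbhs; split=> //; exact: DU.
    exists r => // u v au vb tu ut tv vt [s [s1 s2 s3 s4]].
    have uv : u <= v by exact: le_trans ut tv.
    exists ((u, v) :: s); split.
    - move=> i; rewrite inE => /predU1P[->//|/s1[h1 [h2 h3]]]; split=> //; split=> //.
      exact: le_trans uv.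
    - rewrite pairwise_cons s2 andbT; apply/allP => i /s1[_ [_ h]]; exact: h.
    - rewrite big_cons /= EFinD.
      have -> : (v - u)%:E = mu `]u, v]%classic.
        rewrite /mu lebesgue_measure_itv/= lte_fin; case: ltgtP uv => // -> _.
        by rewrite subrr.
      apply: le_trans (leeD2l _ s3) _.
      have mI : measurable (U `&` `]a, u]) by exact: measurableI.
      rewrite -measureU//; last first.
        apply/seteqP; split=> y //= [] + [_]; rewrite !in_itv /=.
        by move=> /andP[h1 _] /andP[_ h2]; move: h1; rewrite ltNge h2.
      apply: le_measure; rewrite ?inE; [exact: measurableU|exact: measurableI|].
      move=> y [|[Uy]]; rewrite /= !in_itv /= => /andP[h1 h2]; last first.
        by split=> //; rewrite h1 (le_trans h2).
      split; last by rewrite h2 (le_lt_trans au).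
      by apply: Hr; rewrite /ball /= ltr_distlC; apply/andP; split; lra.
    - rewrite big_cons /=; have := ler_norm (w v - w u).
      have : eps * (u - a) <= eps * (v - a) by rewrite ler_pM2l// lerB.
      lra.
  have [dw hdw dw0] : exists2 v : R, is_derive t 1 w v & v <= 0.
    apply: contrapT => H; apply: tND; apply: HD => /= /(_ _)/H; apply.
    by rewrite tgea.
  have [r r0 Hr] := (is_deriveP w t dw).1 hdw eps eps0.
  exists r => // u v au vb tu ut tv vt [s [s1 s2 s3 s4]].
  exists s; split=> //.
  - move=> i /s1[h1 [h2 h3]]; split=> //; split=> //.
    exact: le_trans (le_trans ut tv).
  - apply: le_trans s3 _; apply: le_measure; rewrite ?inE; try exact: measurableI.
    move=> y [Uy]; rewrite /= !in_itv /= => /andP[h1 h2]; split=> //.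
    by rewrite h1 (le_trans h2)// (le_trans ut).
  have B1 : w v - w t <= eps * (v - t).
    have := Hr (v - t); rewrite subrKC ger0_norm ?subr_ge0//.
    move=> /(_ ltac:(lra)) /(le_trans (ler_norm _)).
    rewrite /GRing.scale /= => H.
    have : (v - t) * dw <= 0 by rewrite mulr_ge0_le0// subr_ge0.
    lra.
  have B2 : w t - w u <= eps * (t - u).
    have := Hr (u - t); rewrite subrKC distrC ger0_norm ?subr_ge0//.
    move=> /(_ ltac:(lra)); rewrite -normrN.
    move=>  /(le_trans (ler_norm _)).
    rewrite /GRing.scale /= => H.
    have : (t - u) * dw <= 0 by rewrite mulr_ge0_le0// subr_ge0.
    lra.
  lra.
move=> [s [s1 s2 s3 s4]].
pose x0 := (0, 0) : R * R.
have mS (i : 'I_(size s)) : nth x0 s i \in s by exact: mem_nth.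
have tr : trivIset setT
    (fun i : 'I_(size s) => `](nth x0 s i).1, (nth x0 s i).2[%classic).
  apply/trivIsetP => i j _ _.
  wlog: i j / (i < j)%N.
    move=> W; have [ij _|ij _|/val_inj->] := ltngtP i j; last by rewrite eqxx.
      by apply: W => //; rewrite neq_ltn ij.
    by rewrite setIC; apply: W => //; rewrite neq_ltn ij.
  move=> ij _; apply/seteqP; split=> y //=; rewrite !in_itv /=.
  move=> [/andP[h1 _] /andP[_ h2]].
  have /(pairwiseP x0)/(_ i j) := s2.
  rewrite !inE => /(_ (ltn_ord i) (ltn_ord j) ij) h3.
  by have := lt_trans h1 (lt_le_trans h2 h3); rewrite ltxx.
have small : \sum_(i <- s) (i.2 - i.1) < d.
  rewrite -lte_fin; apply: le_lt_trans muU; apply: le_trans s3 _.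
  by apply: le_measure; rewrite ?inE//; exact: measurableI.
have := Hd (size s) (fun i => (nth x0 s i).1) (fun i => (nth x0 s i).2)
  (fun i => s1 _ (mS i)) tr.
have -> : \sum_(i < size s) ((nth x0 s i).2 - (nth x0 s i).1) =
    \sum_(i <- s) (i.2 - i.1) by rewrite [RHS](big_nth x0) big_mkord.
have -> : \sum_(i < size s) `|w (nth x0 s i).2 - w (nth x0 s i).1| =
    \sum_(i <- s) `|w i.2 - w i.1| by rewrite [RHS](big_nth x0) big_mkord.
move=> /(_ small) H.
have : eps * (b - a) + eps = e by rewrite /eps; field; rewrite gt_eqF.
lra.
Qed.

(** The term [v - u] allows an explicit dependence of [y] on time, such as the exponential weight in
    Gronwall's inequality; with a constant [x] it covers Lipschitz functions. *)
Lemma abs_continuous_comp (R : realType) (V W : normedModType R) (a b : R)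
    (x : R -> V) (y : R -> W) (K : R) : 0 < K ->
  (forall u v, a <= u -> u <= v -> v <= b ->
     `|y v - y u| <= K * (`|x v - x u| + (v - u))) ->
  abs_continuous a b x -> abs_continuous a b y.
Proof.
move=> K0 H acx e e0.
have e20 : 0 < e / (2 * K) by rewrite divr_gt0// mulr_gt0.
have [d d0 Hd] := acx _ e20.
exists (Num.min d (e / (2 * K))); first by rewrite lt_min d0.
move=> n u v uv tr; rewrite lt_min => /andP[h1 h2].
have h3 := Hd n u v uv tr h1.
apply: (@le_lt_trans _ _
  (\sum_(i < n) K * (`|x (v i) - x (u i)| + (v i - u i)))).
  by apply: ler_sum => i _; have [? [? ?]] := uv i; exact: H.
rewrite -mulr_sumr big_split /=.
have -> : e = K * (e / (2 * K) + e / (2 * K)).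
  by field; rewrite gt_eqF.
by rewrite ltr_pM2l// ltrD.
Qed.

(** * The set-valued right-hand side *)

Section Continuity.
Context {R : realType} {T : topologicalType}.
Implicit Types f g : T -> R.

Lemma continuous_cst_fun (k : R) : continuous (fun _ : T => k).
Proof. by move=> x; exact: cvg_cst. Qed.

Lemma continuous_add f g : continuous f -> continuous g ->
  continuous (fun x => f x + g x).
Proof. by move=> cf cg x; apply: cvgD; [exact: cf|exact: cg]. Qed.

Lemma continuous_opp f : continuous f -> continuous (fun x => - f x).
Proof. by move=> cf x; apply: cvgN; exact: cf. Qed.

Lemma continuous_mul f g : continuous f -> continuous g ->
  continuous (fun x => f x * g x).
Proof. by move=> cf cg x; apply: cvgM; [exact: cf|exact: cg]. Qed.

Lemma continuous_inv f : (forall x, f x != 0) -> continuous f ->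
  continuous (fun x => (f x)^-1).
Proof. by move=> f0 cf x; apply: cvgV => //; exact: cf. Qed.

Lemma continuous_norm f : continuous f -> continuous (fun x => `|f x|).
Proof. by move=> cf x; apply: cvg_norm; exact: cf. Qed.

Lemma continuous_exp f n : continuous f -> continuous (fun x => f x ^+ n).
Proof.
move=> cf; elim: n => [|n IH]; first exact: continuous_cst_fun.
have -> : (fun x => f x ^+ n.+1) = fun x => f x * f x ^+ n.
  by apply/funext => x; rewrite exprS.
exact: continuous_mul.
Qed.

Lemma continuous_fun_sin f : continuous f -> continuous (fun x => sin (f x)).
Proof. by move=> cf x; apply: continuous_comp; [exact: cf|exact: continuous_sin]. Qed.

Lemma continuous_fun_cos f : continuous f -> continuous (fun x => cos (f x)).
Proof. by move=> cf x; apply: continuous_comp; [exact: cf|exact: continuous_cos]. Qed.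

Lemma continuous_min f g : continuous f -> continuous g ->
  continuous (fun x => Num.min (f x) (g x)).
Proof.
move=> cf cg.
have -> : (fun x => Num.min (f x) (g x)) =
    fun x => (f x + g x - `|f x - g x|) / 2.
  apply/funext => x; rewrite /Num.min; case: ltP => h.
    by rewrite ltr0_norm ?subr_lt0//; field.
  by rewrite ger0_norm ?subr_ge0//; field.
apply: continuous_mul; last exact: continuous_cst_fun.
apply: continuous_add; first exact: continuous_add.
by apply/continuous_opp/continuous_norm/continuous_add => //; exact: continuous_opp.
Qed.

Lemma continuous_max f g : continuous f -> continuous g ->
  continuous (fun x => Num.max (f x) (g x)).
Proof.
move=> cf cg.
have -> : (fun x => Num.max (f x) (g x)) =
    fun x => - Num.min (- f x) (- g x).
  by apply/funext => x; rewrite -oppr_max opprK.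
by apply/continuous_opp/continuous_min; exact: continuous_opp.
Qed.

Lemma closed_sublevel f : continuous f -> closed [set x | f x <= 0].
Proof.
move=> cf; apply: (@preimage_closed _ _ f [set y | y <= 0]); last exact: closed_le.
by move=> x _; exact: cf.
Qed.

Lemma closed_zeros f : continuous f -> closed [set x | f x = 0].
Proof.
move=> cf; apply: (@preimage_closed _ _ f [set y | y = 0]); last exact: closed_eq.
by move=> x _; exact: cf.
Qed.

End Continuity.

Lemma continuous_comp_fun (T S U : topologicalType) (f : T -> S) (g : S -> U) :
  continuous f -> continuous g -> continuous (fun x => g (f x)).
Proof. by move=> cf cg x; apply: continuous_comp; [exact: cf|exact: cg]. Qed.

Lemma continuous_fst (T S U : topologicalType) (f : U -> T * S) :
  continuous f -> continuous (fun x => (f x).1).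
Proof. by move=> cf x; apply: (cvg_comp f fst); [exact: cf|exact: cvg_fst]. Qed.

Lemma continuous_snd (T S U : topologicalType) (f : U -> T * S) :
  continuous f -> continuous (fun x => (f x).2).
Proof. by move=> cf x; apply: (cvg_comp f snd); [exact: cf|exact: cvg_snd]. Qed.

Lemma continuous_pair (T S U : topologicalType)
    (f : U -> T) (g : U -> S) :
  continuous f -> continuous g -> continuous (fun x => (f x, g x)).
Proof. by move=> cf cg x; apply: cvg_pair; [exact: cf|exact: cg]. Qed.

(** Descends along the expression; what is not decomposed, and a projection already known to be
    continuous, is closed from the context. *)
Ltac continuity := lazymatch goal with
  | |- continuous (fun x => x) => by move=> ?; exact: cvg_id
  | |- continuous (fun _ => ?k) => by move=> ?; exact: cvg_cst
  | |- continuous (fun x => @?f x + @?g x) =>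
      apply: (@continuous_add _ _ f g); continuity
  | |- continuous (fun x => - @?f x) => apply: (@continuous_opp _ _ f); continuity
  | |- continuous (fun x => @?f x * @?g x) =>
      apply: (@continuous_mul _ _ f g); continuity
  | |- continuous (fun x => `|@?f x|) => apply: (@continuous_norm _ _ f); continuity
  | |- continuous (fun x => @?f x ^+ ?n) =>
      apply: (@continuous_exp _ _ f n); continuity
  | |- continuous (fun x => sin (@?f x)) =>
      apply: (@continuous_fun_sin _ _ f); continuity
  | |- continuous (fun x => cos (@?f x)) =>
      apply: (@continuous_fun_cos _ _ f); continuity
  | |- continuous (fun x => Num.min (@?f x) (@?g x)) =>
      apply: (@continuous_min _ _ f g); continuity
  | |- continuous (fun x => Num.max (@?f x) (@?g x)) =>
      apply: (@continuous_max _ _ f g); continuity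
  | |- continuous (fun x => (@?f x, @?g x)) =>
      apply: (@continuous_pair _ _ _ f g); continuity
  | |- continuous (fun x => (@?f x).1) =>
      first [assumption | apply: (@continuous_fst _ _ _ f); continuity]
  | |- continuous (fun x => (@?f x).2) =>
      first [assumption | apply: (@continuous_snd _ _ _ f); continuity]
  | _ => assumption
  end.

Section PendulumInclusion.
Context {R : realType}.
Variables (l g mu : R).
Hypotheses (l_gt0 : 0 < l) (mu_gt0 : 0 < mu).

(** [c] stands for the acceleration of the pivot at the current time; the drift is the centre of the
    segment of admissible accelerations. *)
Definition pendulum_drift (c q : R) : R := c / l * sin q - g / l * cos q.

Definition pendulum_friction (c q p : R) : R :=
  mu / l * `|c * cos q - l * p ^+ 2 + g * sin q|.

Lemma pendulum_friction_ge0 c q p : 0 <= pendulum_friction c q p.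
Proof. by rewrite mulr_ge0// ltW// divr_gt0. Qed.

(* The three conditions say that [v.2 = a - b * s] where [s] is the sign of [p]
   if [p != 0] and any element of [[-1, 1]] otherwise. *)
Lemma pendulum_PhiP (xi : R -> R) (x v : R^o * R^o) (t : R) :
  let a := pendulum_drift (xi^`(2)%classic t) x.1 in
  let b := pendulum_friction (xi^`(2)%classic t) x.1 x.2 in
  pendulum_Phi l g mu xi x t v <->
  [/\ v.1 = x.2, `|v.2 - a| <= b & (v.2 - a) * x.2 = - b * `|x.2|].
Proof.
set c := xi^`(2)%classic t; move=> a b.
pose a' (y : R^o * R^o) := pendulum_drift c y.1.
pose b' (y : R^o * R^o) := pendulum_friction c y.1 y.2.
have rhsE y : pendulum_rhs l g mu xi y t = (y.2, a' y - b' y * (y.2 / `|y.2|)).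
  rewrite /pendulum_rhs -/c; congr (_, _).
  by rewrite /a' /b' /pendulum_drift /pendulum_friction; ring.
(* The three conditions as a set of pairs (state, velocity). It is closed in both variables jointly,
   so the conditions pass to limit values, along which the state varies too. *)
pose G (z : (R^o * R^o) * (R^o * R^o)) :=
  [/\ z.2.1 = z.1.2, `|z.2.2 - a' z.1| <= b' z.1 &
      (z.2.2 - a' z.1) * z.1.2 = - b' z.1 * `|z.1.2|].
have clG : closed G.
  have -> : G = [set z | z.2.1 - z.1.2 = 0] `&`
      ([set z | `|z.2.2 - a' z.1| - b' z.1 <= 0] `&`
      [set z | (z.2.2 - a' z.1) * z.1.2 + b' z.1 * `|z.1.2| = 0]).
    apply/seteqP; split=> z /=.
      by move=> [-> h ->]; rewrite subrr subr_le0 mulNr addNr.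
    by move=> [/subr0_eq h1 [/[!subr_le0] h2 /eqP]]; rewrite addr_eq0 -mulNr => /eqP.
  apply: closedI; last apply: closedI.
  - apply: closed_zeros.
    by continuity.
  - apply: closed_sublevel.
    by rewrite /a' /b' /pendulum_drift /pendulum_friction; continuity.
  - apply: closed_zeros.
    by rewrite /a' /b' /pendulum_drift /pendulum_friction; continuity.
have Grhs y : y.2 != 0 -> G (y, pendulum_rhs l g mu xi y t).
  move=> y0; have ny : `|y.2| != 0 by rewrite normr_eq0.
  rewrite rhsE; split => //=.
    have s1 : `|y.2 / `|y.2| | = 1 by rewrite normrM normfV normr_id divff.
    rewrite addrAC subrr sub0r normrN normrM s1 mulr1.
    by rewrite ger0_norm ?pendulum_friction_ge0.
  have s2 : y.2 / `|y.2| * y.2 = `|y.2|.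
    by rewrite mulrAC -expr2 -real_normK ?num_real// expr2 mulfK.
  by rewrite addrAC subrr sub0r !mulNr -[b' y * _ * _]mulrA s2.
split=> [|Gv].
  suff : pendulum_Phi l g mu xi x t `<=` [set v | G (x, v)] by apply.
  apply: bigcap_inf => /=; split; first split.
  - have cx : continuous (fun u : R^o * R^o => (x, u)) by continuity.
    by apply: (@preimage_closed _ _ (fun u => (x, u)) G) clG => u _; exact: cx.
  - move=> u w k; rewrite !inE /G /= => -[u1 u2 u3] [w1 w2 w3].
    have k0 : 0 <= k%:num by [].
    have k1 : 0 <= 1 - k%:num by rewrite subr_ge0.
    rewrite /conv/= /unstable.onem; split => /=.
    + by rewrite u1 w1 -scalerDl subrKC scale1r.
    + rewrite (_ : _ - _ = k%:num * (u.2 - a' x) + (1 - k%:num) * (w.2 - a' x)); last first.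
        by rewrite /GRing.scale/=; ring.
      apply: (le_trans (ler_normD _ _)); rewrite !normrM (ger0_norm k0) (ger0_norm k1).
      have := ler_wpM2l k0 u2; have := ler_wpM2l k1 w2; lra.
    + rewrite (_ : _ - _ = k%:num * (u.2 - a' x) + (1 - k%:num) * (w.2 - a' x)); last first.
        by rewrite /GRing.scale/=; ring.
      by rewrite mulrDl -!mulrA u3 w3; ring.
  - move=> w cw; apply: clG => N /nbhs_ballP[e /= e0 HN].
    pose A := [set u | exists2 y : R^o * R^o, y.2 != 0 /\ ball x e y &
                         pendulum_rhs l g mu xi y t = u].
    have [|_ [[y [y0 xy] <-] wy]] := cw A _ _ (nbhsx_ballx w e e0).
      rewrite /fmap /= /within /=; apply/nbhs_ballP; exists e => // y xy y0.
      by exists y.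
    by exists (y, pendulum_rhs l g mu xi y t); split; [exact: Grhs | exact: HN].
move=> C [[clC cvC] HC].
(* If [x.2 != 0], the point [x] itself belongs to the domain, so the right-hand side at [x] is a
   limit value. *)
have [p0|p0] := eqVneq x.2 0; last first.
  apply: HC => S N /= FS vN; exists v; split; last exact: nbhs_singleton.
  suff -> : v = pendulum_rhs l g mu xi x t.
    by move: FS; rewrite /fmap /= /within /= => /nbhs_singleton; exact.
  have [v1 v2 v3] := Gv; rewrite rhsE [LHS]surjective_pairing v1; congr (_, _).
  apply/(addIr (- a' x))/(mulIf p0); rewrite v3.
  have [_ _] := Grhs _ p0; rewrite rhsE => h; exact: esym h.
(* The ends of the segment are the limits along the rays [p = e * s] with [e] decreasing to 0; [k]
   continues the right-hand side along the ray up to [e = 0]. *)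
have Cend (s : R) : `|s| = 1 -> C (0, a - b * s).
  move=> s1; apply: HC => S N /= FS vN.
  pose h (e : R) : R^o * R^o := (x.1, e * s).
  have ch : continuous h by rewrite /h; continuity.
  have h0 : h 0 = x by rewrite /h mul0r -p0 -surjective_pairing.
  pose k (e : R) : R^o * R^o := (e * s, a' (h e) - b' (h e) * s).
  have ck : continuous k.
    by rewrite /k /a' /b' /pendulum_drift /pendulum_friction; continuity.
  have k0 : k 0 = (0, a - b * s) by rewrite /k h0 mul0r.
  have nS : \forall e \near (0 : R), 0 < e -> S (pendulum_rhs l g mu xi (h e) t).
    move: FS; rewrite /fmap /= /within /= -h0 => /(ch 0) H.
    move: H; apply: (@filterS R (nbhs (0:R)) _) => e /= he e0; apply: he.
    by rewrite mulf_neq0 ?(gt_eqF e0)// -normr_gt0 s1.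
  have nN : \forall e \near (0 : R), N (k e).
    by move: vN; rewrite -k0 => /(ck 0).
  have /nbhs_ballP[r /= r0 Hr] : nbhs (0 : R)
    [set e | (0 < e -> S (pendulum_rhs l g mu xi (h e) t)) /\ N (k e)].
    exact: filterI.
  have r2 : 0 < r / 2 by rewrite divr_gt0.
  have [|Sr Nr] := Hr (r / 2).
    by rewrite /ball /= sub0r normrN gtr0_norm//; lra.
  have E : pendulum_rhs l g mu xi (h (r / 2)) t = k (r / 2).
    rewrite rhsE /k /=; congr (_, _ - _ * _).
    by rewrite normrM s1 mulr1 gtr0_norm// mulrAC divff ?mul1r// gt_eqF.
  by exists (k (r / 2)); split => //; rewrite -E; exact: Sr.
have [v1 v2 _] := Gv; rewrite p0 in v1.
have b0 : 0 <= b by exact: pendulum_friction_ge0.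
have [be0|bn0] := eqVneq b 0.
  have : C (0, a - b * 1) by apply: Cend; rewrite normr1.
  rewrite be0 mul0r subr0; congr (C _).
  move: v2; rewrite be0 normr_le0 subr_eq0 => /eqP va.
  by rewrite [RHS]surjective_pairing v1 va.
have bp : 0 < b by rewrite lt_neqAle eq_sym bn0.
(* This weight solves [lam * (a - b) + (1 - lam) * (a + b) = v.2]. *)
have l01 : 0 <= (1 - (v.2 - a) / b) / 2 <= 1.
  move: v2; rewrite ler_norml -/b => /andP[h1 h2].
  have : -1 <= (v.2 - a) / b by rewrite ler_pdivlMr// mulN1r.
  have : (v.2 - a) / b <= 1 by rewrite ler_pdivrMr// mul1r.
  by move=> ? ?; apply/andP; split; lra.
have /andP[lam0 lam1] := l01.
pose lam := Itv01 lam0 lam1.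
have := cvC (0, a - b * 1) (0, a - b * (-1)) lam.
rewrite !inE => /(_ (Cend 1 (normr1 _)) (Cend (-1) (normrN1 _))).
congr (C _); rewrite /conv /= /unstable.onem [RHS]surjective_pairing v1 /GRing.scale /=.
congr (_, _); rewrite /= /GRing.scale /=; first by ring.
by field.
Qed.
End PendulumInclusion.

(** * Forward uniqueness *)

(** Applied to a single interval, absolute continuity is uniform continuity: along the segment the
    bound grows by at most 1 for each step shorter than [d]. *)
Lemma abs_continuous_bounded (R : realType) (V : normedModType R) (a b : R)
    (x : R -> V) : a <= b -> abs_continuous a b x ->
  exists M : R, forall t, a <= t <= b -> `|x t| <= M.
Proof.
move=> ab acx; have [d d0 Hd] := acx 1 ltr01.
have step u v : a <= u -> u <= v -> v <= b -> v - u < d -> `|x v - x u| < 1.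
  move=> au uv vb vud; have := Hd 1%N (fun=> u) (fun=> v); rewrite !big_ord1; apply=> //.
  by apply/trivIsetP => i j _ _; rewrite !ord1 eqxx.
suff : exists M, forall t, a <= t -> t <= b -> `|x t| <= M.
  by move=> [M HM]; exists M => t /andP[]; exact: HM.
apply: (segment_ind (P := fun s => exists M, forall t, a <= t -> t <= s -> `|x t| <= M)
  ab).
  by exists `|x a| => t h1 h2; rewrite (@le_anti _ _ t a)// h1 h2.
move=> t tab; exists (d / 2); first by rewrite divr_gt0.
move=> u v au vb h1 h2 h3 h4 [M HM]; exists (Num.max M (`|x u| + 1)) => s as' sv.
rewrite le_max; have [su|us] := leP s u; first by rewrite HM.
apply/orP; right; rewrite -(subrK (x u) (x s)) (le_trans (ler_normD _ _))//.
rewrite addrC lerD2l; apply/ltW/step => //; [exact: ltW|exact: le_trans vb|lra].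
Qed.

Lemma abs_continuousB (R : realType) (V : normedModType R) (a b : R)
    (x y : R -> V) :
  abs_continuous a b x -> abs_continuous a b y ->
  abs_continuous a b (fun t => x t - y t).
Proof.
move=> acx acy e e0; have e20 : 0 < e / 2 by rewrite divr_gt0.
have [d1 d10 H1] := acx _ e20; have [d2 d20 H2] := acy _ e20.
exists (Num.min d1 d2); first by rewrite lt_min d10.
move=> n u v uv tr; rewrite lt_min => /andP[h1 h2].
have := ltrD (H1 n u v uv tr h1) (H2 n u v uv tr h2).
rewrite -splitr; apply: le_lt_trans; rewrite -big_split /=.
apply: ler_sum => i _.
have -> : x (v i) - y (v i) - (x (u i) - y (u i)) =
  (x (v i) - x (u i)) - (y (v i) - y (u i)) by rewrite !opprD addrACA.
exact: ler_normB.
Qed.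

(* The weight [expR (- 2 L (t - a))] makes the squared norm nonincreasing. *)
Lemma abs_continuous_gronwall (R : realType) (d : R -> R^o * R^o) (a b L : R) :
  0 <= L -> abs_continuous a b d -> d a = 0 ->
  {ae @lebesgue_measure R, forall t, a <= t <= b ->
    exists2 v, is_derive t 1 d v &
      (d t).1 * v.1 + (d t).2 * v.2 <= L * ((d t).1 ^+ 2 + (d t).2 ^+ 2)} ->
  a <= b -> d b = 0.
Proof.
move=> L0 acd da Hae ab.
have [M HM] := abs_continuous_bounded ab acd.
have M0 : 0 <= M by apply: le_trans (HM a _); rewrite ?lexx.
pose w (t : R) : R := (d t).1 ^+ 2 + (d t).2 ^+ 2.
pose f (t : R) : R := expR (- (2 * L) * (t - a)).
pose G (t : R) : R^o := f t * w t.
have dM t : a <= t -> t <= b -> `|(d t).1| <= M /\ `|(d t).2| <= M.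
  move=> at' tb; have := HM t; rewrite at' tb prod_normE ge_max => /(_ isT) /andP[].
  by [].
have wM t : a <= t -> t <= b -> 0 <= w t <= 2 * M ^+ 2.
  move=> h1 h2; have [h3 h4] := dM t h1 h2.
  rewrite addr_ge0 ?sqr_ge0//= mulr_natl mulr2n lerD//;
    by rewrite -real_normK ?num_real// ler_sqr ?nnegrE.
have sqB (x y : R) : `|x| <= M -> `|y| <= M -> `|x ^+ 2 - y ^+ 2| <= 2 * M * `|x - y|.
  move=> hx hy; rewrite subr_sqr normrM mulrC ler_wpM2r// (le_trans (ler_normD _ _))//.
  by rewrite mulr_natl mulr2n lerD.
have f01 t : a <= t -> 0 <= f t <= 1.
  move=> h; rewrite expR_ge0 /= -[leRHS]expR0 ler_expR mulNr oppr_le0.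
  by rewrite !mulr_ge0// subr_ge0.
have fB u v : a <= u -> u <= v -> `|f v - f u| <= 2 * L * (v - u).
  move=> au uv; have -> : f v = f u * expR (- (2 * L * (v - u))).
    by rewrite -expRD; congr expR; ring.
  have k0 : 0 <= 2 * L * (v - u) by rewrite !mulr_ge0// subr_ge0.
  have := expR_ge1Dx (- (2 * L * (v - u))).
  have : expR (- (2 * L * (v - u))) <= 1 by rewrite -[leRHS]expR0 ler_expR oppr_le0.
  have /andP[fu0 fu1] := f01 u au.
  rewrite distrC -[X in `|X - _|]mulr1 -mulrBr => h1 h2.
  rewrite normrM ger0_norm// ger0_norm ?subr_ge0//.
  apply: (@le_trans _ _ (1 * (2 * L * (v - u)))); last by rewrite mul1r.
  by rewrite ler_pM// ?subr_ge0//; lra.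
have acG : abs_continuous a b G.
  (* On [[- M, M]] the square is Lipschitz with constant [2 * M], for each of two coordinates; the
     weight has constant [2 * L] and multiplies [w <= 2 * M ^+ 2]. *)
  pose K := 4 * M + 2 * L * (2 * M ^+ 2) + 1.
  have K0 : 0 < K by rewrite ltr_wpDl// addr_ge0 ?mulr_ge0// sqr_ge0.
  apply: (abs_continuous_comp K0 _ acd) => u v au uv vb.
  have av := le_trans au uv; have ub := le_trans uv vb.
  have [u1 u2] := dM u au ub; have [v1 v2] := dM v av vb.
  have /andP[wu0 wu1] := wM u au ub; have /andP[fv0 fv1] := f01 v av.
  have -> : G v - G u = f v * (w v - w u) + (f v - f u) * w u by rewrite /G; ring.
  have wB : `|w v - w u| <= 4 * M * `|d v - d u|.
    rewrite /w opprD addrACA (le_trans (ler_normD _ _))//.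
    have e1 : `|(d v).1 - (d u).1| <= `|d v - d u| by rewrite prod_normE le_max lexx.
    have e2 : `|(d v).2 - (d u).2| <= `|d v - d u| by rewrite prod_normE le_max lexx orbT.
    have M20 : 0 <= 2 * M by rewrite mulr_ge0.
    have := sqB _ _ v1 u1; have := sqB _ _ v2 u2.
    have := ler_wpM2l M20 e1; have := ler_wpM2l M20 e2; lra.
  have h1 : `|f v * (w v - w u)| <= 4 * M * `|d v - d u|.
    rewrite normrM (ger0_norm fv0) -[leRHS]mul1r; exact: ler_pM.
  have h2 : `|(f v - f u) * w u| <= 2 * L * (v - u) * (2 * M ^+ 2).
    by rewrite normrM (ger0_norm wu0) ler_pM// fB.
  apply: (le_trans (ler_normD _ _)).
  have h3 : 0 <= `|d v - d u| by [].
  have h4 : 0 <= v - u by rewrite subr_ge0.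
  have p1 : 0 <= M * (v - u) by rewrite mulr_ge0.
  have p2 : 0 <= (2 * L * (2 * M ^+ 2)) * `|d v - d u| by rewrite !mulr_ge0// sqr_ge0.
  rewrite /K; lra.
have : G b <= G a.
  apply: (abs_continuous_nonincreasing ab acG).
  apply: negligibleS Hae => t /=; apply: contra_not => Ht tab.
  have [[v1 v2] /is_derive_pairP[dv1 dv2] /= vle] := Ht tab.
  have df : is_derive t 1 f (f t * - (2 * L)).
    have h : is_derive t 1 (fun s : R => - (2 * L) * (s - a)) (- (2 * L)).
      apply/is_deriveP => e e0; exists 1 => // h _.
      rewrite (_ : _ - _ - _ = 0) ?normr0 ?mulr_ge0 ?(ltW e0)//.
      by rewrite /GRing.scale /=; ring.
    exact: (is_derive1_comp (is_derive_expR _) h).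
  eexists.
    have -> : G = f * ((fun s => (d s).1 : R) ^+ 2 + (fun s => (d s).2 : R) ^+ 2) by [].
    exact: (is_deriveM df (is_deriveD (is_deriveX 2 dv1) (is_deriveX 2 dv2))).
  rewrite /GRing.scale /= !expr1.
  have /andP[ft0 _] : 0 <= f t <= 1 by apply: f01; case/andP: tab.
  have -> : ((fun s : R => (d s).1 : R) ^+ 2 + (fun s : R => (d s).2 : R) ^+ 2) t = w t.
    by [].
  by have := ler_wpM2l ft0 vle; rewrite /w; lra.
rewrite {2}/G /w da /= expr0n /= addr0 mulr0 => Gb.
have wb0 : w b <= 0 by rewrite -(pmulr_rle0 _ (expR_gt0 (- (2 * L) * (b - a)))).
have s1 := sqr_ge0 (d b).1; have s2 := sqr_ge0 (d b).2.
have /eqP : (d b).1 ^+ 2 = 0 by apply/le_anti; rewrite s1 andbT; move: wb0; rewrite /w; lra.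
have /eqP : (d b).2 ^+ 2 = 0 by apply/le_anti; rewrite s2 andbT; move: wb0; rewrite /w; lra.
by rewrite !sqrf_eq0 => /eqP h2 /eqP h1; rewrite [LHS]surjective_pairing h1 h2.
Qed.

(** * Lipschitz estimates for the pendulum and uniqueness of its solutions *)

Lemma lipschitz_derive (R : realType) (f df : R -> R) (K : R) :
  (forall x : R, is_derive x 1 f (df x)) -> (forall x, `|df x| <= K) ->
  forall x y, `|f x - f y| <= K * `|x - y|.
Proof.
move=> fdf dfK x y.
wlog: x y / y <= x.
  move=> H; have [|/ltW] := leP y x; first exact: H.
  by rewrite [`|f x - _|]distrC [`|x - _|]distrC; exact: H.
move=> yx; have [|c _ ->] := MVT_segment yx (fun z _ => fdf z).
  apply: continuous_subspaceT => z; apply: differentiable_continuous.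
  by apply/derivable1_diffP; case: (fdf z).
by rewrite normrM ler_wpM2r.
Qed.

Lemma lipschitzP (R : realType) (f : R -> R) : lipschitz f ->
  exists2 K : R, 0 < K & forall x y, `|f x - f y| <= K * `|x - y|.
Proof.
move=> /pinfty_ex_gt0[K K0 HK]; exists K => // x y.
exact: (HK (x, y)).
Qed.

Section PendulumUniqueness.
Context {R : realType}.
Variables (l g mu : R).
Hypotheses (l_gt0 : 0 < l) (g_gt0 : 0 < g) (mu_gt0 : 0 < mu).

Lemma sin_lipschitz (x y : R) : `|sin x - sin y| <= `|x - y|.
Proof.
rewrite -[leRHS]mul1r.
apply: (lipschitz_derive (@is_derive_sin R)) => z.
by rewrite ler_norml cos_geN1 cos_le1.
Qed.

Lemma cos_lipschitz (x y : R) : `|cos x - cos y| <= `|x - y|.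
Proof.
rewrite -[leRHS]mul1r.
apply: (lipschitz_derive (@is_derive_cos R)) => z.
by rewrite normrN ler_norml sin_geN1 sin_le1.
Qed.

Lemma pendulum_drift_lipschitz (c q1 q2 : R) :
  `|pendulum_drift l g c q1 - pendulum_drift l g c q2| <=
  (`|c| + g) / l * `|q1 - q2|.
Proof.
rewrite (_ : _ - _ = (c * (sin q1 - sin q2) - g * (cos q1 - cos q2)) / l);
  last by rewrite /pendulum_drift; ring.
rewrite normrM mulrAC normfV (gtr0_norm l_gt0) ler_pM2r ?invr_gt0//.
rewrite (le_trans (ler_normB _ _))// mulrDl !normrM (gtr0_norm g_gt0).
by rewrite lerD// ?ler_wpM2l ?(ltW g_gt0) ?sin_lipschitz ?cos_lipschitz.
Qed.

(** The friction is quadratic in the speed, so its constant depends on a bound [M] of the speeds,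
    through [p1 ^+ 2 - p2 ^+ 2 = (p1 + p2) * (p1 - p2)]. *)
Lemma pendulum_friction_lipschitz (M c q1 q2 p1 p2 : R) :
  `|p1| <= M -> `|p2| <= M ->
  `|pendulum_friction l g mu c q1 p1 - pendulum_friction l g mu c q2 p2| <=
  mu / l * ((`|c| + g) * `|q1 - q2| + 2 * l * M * `|p1 - p2|).
Proof.
move=> p1M p2M; rewrite -mulrBr normrM.
have ml0 : 0 < mu / l by rewrite divr_gt0.
rewrite (gtr0_norm ml0) ler_pM2l//.
rewrite (le_trans (ler_dist_dist _ _))//.
rewrite (_ : _ - _ = c * (cos q1 - cos q2) + g * (sin q1 - sin q2) +
  - (l * ((p1 + p2) * (p1 - p2)))); last by ring.
rewrite (le_trans (ler_normD _ _))// lerD//.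
  rewrite (le_trans (ler_normD _ _))// mulrDl !normrM (gtr0_norm g_gt0).
  by rewrite lerD// ?ler_wpM2l ?(ltW g_gt0) ?sin_lipschitz ?cos_lipschitz.
rewrite normrN !normrM (gtr0_norm l_gt0) mulrA ler_wpM2r//.
rewrite [2 * l]mulrC -mulrA ler_pM2l// (le_trans (ler_normD _ _))//.
by rewrite mulr_natl mulr2n lerD.
Qed.

(* Dry friction is dissipative: the jump of its sign only helps. *)
Lemma friction_dissipative (a1 b1 p1 v1 a2 b2 p2 v2 : R) :
  `|v1 - a1| <= b1 -> (v1 - a1) * p1 = - b1 * `|p1| ->
  `|v2 - a2| <= b2 -> (v2 - a2) * p2 = - b2 * `|p2| ->
  (p1 - p2) * (v1 - v2) <= `|p1 - p2| * (`|a1 - a2| + `|b1 - b2|).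
Proof.
set d1 := v1 - a1; set d2 := v2 - a2 => d1b e1 d2b e2.
have -> : (p1 - p2) * (v1 - v2) = (p1 - p2) * (a1 - a2) +
  (d1 * p1 + d2 * p2 - d1 * p2 - d2 * p1) by rewrite /d1 /d2; ring.
rewrite [leRHS]mulrDr lerD//; first by rewrite -normrM ler_norm.
have h1 : - (d1 * p2) <= b1 * `|p2|.
  by rewrite -normrN in d1b; rewrite -mulNr (le_trans (ler_norm _))// normrM ler_wpM2r.
have h2 : - (d2 * p1) <= b2 * `|p1|.
  by rewrite -normrN in d2b; rewrite -mulNr (le_trans (ler_norm _))// normrM ler_wpM2r.
apply: (@le_trans _ _ (- ((`|p1| - `|p2|) * (b1 - b2)))).
  by rewrite e1 e2; lra.
rewrite (le_trans (ler_norm _))// normrN normrM ler_wpM2r//.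
exact: ler_dist_dist.
Qed.

(** The left-hand side is half the derivative of the squared distance of two solutions. In the
    constant, [1] comes from [q' = p], the next two terms from drift and friction as functions of
    [q], the last from friction as a function of [p]. *)
Lemma pendulum_one_sided (C M c q1 p1 v1 q2 p2 v2 : R) :
  `|c| <= C -> `|p1| <= M -> `|p2| <= M ->
  let a q := pendulum_drift l g c q in
  let b q p := pendulum_friction l g mu c q p in
  `|v1 - a q1| <= b q1 p1 -> (v1 - a q1) * p1 = - b q1 p1 * `|p1| ->
  `|v2 - a q2| <= b q2 p2 -> (v2 - a q2) * p2 = - b q2 p2 * `|p2| ->
  (q1 - q2) * (p1 - p2) + (p1 - p2) * (v1 - v2) <=
  (1 + (C + g) / l + mu / l * (C + g) + 2 * mu * M) *
  ((q1 - q2) ^+ 2 + (p1 - p2) ^+ 2).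
Proof.
move=> cC p1M p2M a b h1 e1 h2 e2.
have := friction_dissipative h1 e1 h2 e2.
have := pendulum_drift_lipschitz c q1 q2.
have := pendulum_friction_lipschitz c q1 q2 p1M p2M.
rewrite -/(a q1) -/(a q2) -/(b q1 p1) -/(b q2 p2).
set da := `|a q1 - a q2|; set db := `|b q1 p1 - b q2 p2|.
have : (q1 - q2) * (p1 - p2) <= `|q1 - q2| * `|p1 - p2|.
  by rewrite -normrM ler_norm.
rewrite -[(q1 - q2) ^+ 2]real_normK ?num_real// -[(p1 - p2) ^+ 2]real_normK ?num_real//.
set X := `|q1 - q2|; set Y := `|p1 - p2| => hXY hb ha hv.
have X0 : 0 <= X by exact: normr_ge0.
have Y0 : 0 <= Y by exact: normr_ge0.
have li0 : 0 < l^-1 by rewrite invr_gt0.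
have C0 : 0 <= C by apply: le_trans cC.
have M0 : 0 <= M by apply: le_trans p1M.
have ha' : da <= (C + g) / l * X.
  by apply: (le_trans ha); rewrite ler_wpM2r// ler_pM2r// lerD2r.
have hb' : db <= mu / l * (C + g) * X + 2 * mu * M * Y.
  apply: (le_trans hb); rewrite mulrDr lerD//.
    by rewrite mulrA ler_wpM2r// ler_pM2l ?divr_gt0// lerD2r.
  by rewrite le_eqVlt; apply/orP; left; apply/eqP; field; rewrite gt_eqF.
have := ler_wpM2l Y0 (lerD ha' hb').
have XY : X * Y <= X ^+ 2 + Y ^+ 2.
  by have := sqr_ge0 (X - Y); have := sqr_ge0 X; have := sqr_ge0 Y; nra.
set k1 := (C + g) / l; set k2 := mu / l * (C + g); set k3 := 2 * mu * M.
have Cg0 : 0 <= C + g by rewrite addr_ge0// ltW.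
have k10 : 0 <= k1 by rewrite divr_ge0// ltW.
have k20 : 0 <= k2 by rewrite mulr_ge0// ltW// divr_gt0.
have k30 : 0 <= k3 by rewrite mulr_ge0// mulr_ge0// ltW.
have := ler_wpM2l k10 XY; have := ler_wpM2l k20 XY.
have := mulr_ge0 k30 (sqr_ge0 X).
lra.
Qed.

Lemma pendulum_solution_unique (xi : R -> R) (t0 : R) (x y : R -> R^o * R^o) :
  lipschitz xi^`(2)%classic ->
  is_solution (pendulum_Phi l g mu xi) `[t0, +oo[ x ->
  is_solution (pendulum_Phi l g mu xi) `[t0, +oo[ y ->
  x t0 = y t0 -> forall t, t0 <= t -> x t = y t.
Proof.
move=> /lipschitzP[K K0 HK] [acx aex] [acy aey] xy0 t t0t.
have mem s : t0 <= s -> s \in `[t0, +oo[ by rewrite in_itv /= => ->.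
have {}acx := acx t0 t (mem _ (lexx _)) (mem _ t0t).
have {}acy := acy t0 t (mem _ (lexx _)) (mem _ t0t).
have [M1 HM1] := abs_continuous_bounded t0t acx.
have [M2 HM2] := abs_continuous_bounded t0t acy.
(* Both solutions and the acceleration of the pivot are bounded between [t0] and [t], by [M] and
   [C], so the one-sided constant is finite there. *)
pose M := Num.max M1 M2.
have M0 : 0 <= M.
  by rewrite le_max (le_trans _ (HM1 t0 _)) ?lexx.
pose C := `|xi^`(2)%classic t0| + K * (t - t0).
have C0 : 0 <= C by rewrite addr_ge0// mulr_ge0 ?subr_ge0// ltW.
have HC s : t0 <= s <= t -> `|xi^`(2)%classic s| <= C.
  move=> /andP[t0s st]; rewrite -[X in `|X|](subrKC (xi^`(2)%classic t0)).
  rewrite (le_trans (ler_normD _ _))// lerD2l (le_trans (HK _ _))//.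
  by rewrite ler_pM2l// ger0_norm ?subr_ge0// lerB.
apply/subr0_eq.
pose L := 1 + (C + g) / l + mu / l * (C + g) + 2 * mu * M.
apply: (@abs_continuous_gronwall _ _ t0 t L _ (abs_continuousB acx acy)) => //.
- have Cg0 : 0 <= C + g by rewrite addr_ge0// ltW.
  rewrite /L; do 3 ?apply: addr_ge0 => //; first by rewrite divr_ge0// ltW.
    by rewrite mulr_ge0// ltW// divr_gt0.
  by rewrite mulr_ge0// mulr_ge0// ltW.
- by rewrite xy0 subrr.
have := negligibleU aex aey.
apply: negligibleS => s /= nH; apply: contrapT => /not_orP[Hx Hy]; apply: nH.
move=> /andP[t0s st].
have [v dv Pv] := contrapT Hx (mem _ t0s).
have [u du Pu] := contrapT Hy (mem _ t0s).
exists (v - u); first exact: is_deriveB.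
have [v1 v2 v3] := (pendulum_PhiP g l_gt0 mu_gt0 xi _ _ _).1 Pv.
have [u1 u2 u3] := (pendulum_PhiP g l_gt0 mu_gt0 xi _ _ _).1 Pu.
have st' : t0 <= s <= t by rewrite t0s.
have px : `|(x s).2| <= M.
  by rewrite le_max (le_trans _ (HM1 _ st'))// prod_normE le_max lexx orbT.
have py : `|(y s).2| <= M.
  by rewrite le_max orbC (le_trans _ (HM2 _ st'))// prod_normE le_max lexx orbT.
have := pendulum_one_sided (HC _ st') px py v2 v3 u2 u3.
by rewrite /= -v1 -u1.
Qed.

End PendulumUniqueness.

(** * Limits of discrete trajectories along an ultrafilter *)

(** Compactness gives a cluster point, and an ultrafilter converges to its cluster points since it
    contains each set or its complement. *)
Lemma ultra_bounded_cvg (R : realType) (F : set_system nat) (u : nat -> R) (M : R) :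
  UltraFilter F -> (forall n, `|u n| <= M) -> exists y : R, u @ F --> y.
Proof.
move=> UF uM; have PF : ProperFilter F := @ultra_proper _ _ UF.
have FM : F (u @^-1` `[- M, M]%classic).
  by apply: filterE => n; have := uM n; rewrite ler_norml /preimage /= in_itv.
have [y [_ yF]] := @segment_compact R (- M) M (u @ F) _ FM.
exists y => N yN; have [//|FN] := in_ultra_setVsetC (u @^-1` N) UF.
by have [|z []] := yF (~` N) N _ yN.
Qed.

Section Grid.
Context {R : realType}.
Variables (t0 : R) (F : set_system nat).
Hypotheses (FF : ProperFilter F) (ooF : \oo `<=` F).

(** The square makes the step small even against the slope [n.+1] of the regularized sign. *)
Definition mesh (n : nat) : R := (n.+1%:R ^+ 2)^-1.

Definition grid_index (n : nat) (t : R) : nat := Num.truncn ((t - t0) / mesh n).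

Lemma mesh_gt0 n : 0 < mesh n.
Proof. by rewrite invr_gt0 exprn_gt0. Qed.

Lemma mesh_natr n : n.+1%:R * mesh n = n.+1%:R^-1.
Proof. by rewrite /mesh expr2 invfM mulVKf. Qed.

Lemma near_inv_small (e : R) : 0 < e -> \forall n \near F, n.+1%:R^-1 <= e.
Proof.
move=> e0; apply: ooF.
have /cvgrPdist_le/(_ e e0) : @harmonic R @ \oo --> (0 : R) := cvg_harmonic.
by apply: filterS => n /=; rewrite sub0r normrN ger0_norm.
Qed.

Lemma near_mesh_small (e : R) : 0 < e -> \forall n \near F, mesh n <= e.
Proof.
move=> e0; apply: filterS (near_inv_small e0) => n; apply: le_trans.
rewrite -mesh_natr ler_peMl ?(ltW (mesh_gt0 _))//.
by rewrite ler1n.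
Qed.

Lemma grid_indexP n t : t0 <= t ->
  mesh n * (grid_index n t)%:R <= t - t0 < mesh n * (grid_index n t)%:R + mesh n.
Proof.
move=> t0t; have h0 := mesh_gt0 n.
have /truncn_itv : 0 <= (t - t0) / mesh n by rewrite divr_ge0 ?subr_ge0// ltW.
rewrite -/(grid_index n t) ler_pdivlMr// ltr_pdivrMr// mulrC => /andP[-> /=].
by rewrite -natr1 mulrDl mul1r mulrC.
Qed.

Lemma grid_index_le n u v : u <= v -> (grid_index n u <= grid_index n v)%N.
Proof.
by move=> uv; apply: le_truncn; rewrite ler_pM2r ?invr_gt0 ?mesh_gt0// lerB.
Qed.

Lemma increment_le (s : nat -> R) (d : R) i j : (i <= j)%N ->
  (forall k, (i <= k < j)%N -> s k.+1 - s k <= d) ->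
  s j - s i <= d * (j%:R - i%:R).
Proof.
elim: j => [|j IH]; first by rewrite leqn0 => /eqP-> _; rewrite !subrr mulr0.
rewrite leq_eqVlt => /predU1P[-> _|]; first by rewrite !subrr mulr0.
rewrite ltnS => ij H; have := H j; rewrite ij ltnSn => /(_ isT) hj.
have h : s j - s i <= d * (j%:R - i%:R).
  by apply: IH => // k /andP[ik kj]; apply: H; rewrite ik ltnS (ltnW kj).
by rewrite -[j.+1%:R]natr1; lra.
Qed.

Lemma increment_norm_le (s : nat -> R) (d : R) J :
  (forall k, (k < J)%N -> `|s k.+1 - s k| <= d) ->
  forall i j, (i <= J)%N -> (j <= J)%N -> `|s i - s j| <= d * `|i%:R - j%:R|.
Proof.
move=> H i j; wlog: i j / (i <= j)%N.
  move=> W iJ jJ; have [ij|/ltnW ij] := leqP i j; first exact: W.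
  by rewrite distrC [`|i%:R - _|]distrC; exact: W.
move=> ij _ jJ; rewrite distrC [`|i%:R - _|]distrC [X in d * X]ger0_norm ?subr_ge0 ?ler_nat//.
have Hk k : (i <= k < j)%N -> `|s k.+1 - s k| <= d.
  by move=> /andP[_ kj]; apply/H/(leq_trans kj).
rewrite ler_norml; apply/andP; split.
  rewrite lerNl opprB.
  have := @increment_le (fun k => - s k) d i j ij.
  rewrite opprK addrC; apply=> k /Hk hk; rewrite opprK addrC.
  by apply: le_trans hk; rewrite distrC ler_norm.
by apply: increment_le => // k /Hk; apply: le_trans (ler_norm _).
Qed.

Section Limit.
Variables (S : nat -> nat -> R) (s : R -> R).
Hypothesis cvgS : forall t, t0 <= t -> S n (grid_index n t) @[n --> F] --> s t.

(** Telescoping bounds the increment by [k] times the grid length between [u] and [v], which is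
    [v - u] up to one mesh. *)
Lemma grid_limit_increment (k u v : R) : t0 <= u -> u <= v ->
  (\forall n \near F, forall i, (grid_index n u <= i < grid_index n v)%N ->
     S n i.+1 - S n i <= mesh n * k) ->
  s v - s u <= k * (v - u).
Proof.
move=> t0u uv Hn; apply/ler_addgt0Pr => e e0.
(* Convergence at [u] and at [v] costs [e'] each, rounding to the grid at most [e'] times the
   absolute value of [k]. *)
pose e' := e / (3 + `|k|).
have k3 : 0 < 3 + `|k| by rewrite ltr_wpDr.
have e'0 : 0 < e' by rewrite divr_gt0.
have ee' : e = e' * 3 + e' * `|k| by rewrite -mulrDr /e' mulfVK// gt_eqF.
have /cvgrPdist_le/(_ e' e'0) Hu := cvgS t0u.
have /cvgrPdist_le/(_ e' e'0) Hv := cvgS (le_trans t0u uv).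
have Hm := near_mesh_small e'0.
have : F setT by exact: filterT.
have [n [[Hn1 Hu1] [Hv1 Hm1]]] := filter_ex (filterI (filterI Hn Hu) (filterI Hv Hm)).
move=> _; have := increment_le (grid_index_le n uv) Hn1.
set a := (grid_index n u)%:R; set b := (grid_index n v)%:R.
have /andP[u1 u2] := grid_indexP n t0u.
have /andP[v1 v2] := grid_indexP n (le_trans t0u uv).
move: Hu1 Hv1; rewrite !ler_distl => /andP[h1 h2] /andP[h3 h4] h5.
have h6 : `|mesh n * (b - a) - (v - u)| <= e'.
  by rewrite ler_norml; rewrite -/a -/b in u1 u2 v1 v2; apply/andP; split; lra.
have h7 : k * (mesh n * (b - a) - (v - u)) <= e' * `|k|.
  by rewrite (le_trans (ler_norm _))// normrM mulrC ler_wpM2r.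
lra.
Qed.

Lemma grid_limit_local (k t : R) : t0 <= t ->
  (exists2 d : R, 0 < d & \forall n \near F, forall i,
     `|t0 + mesh n * i%:R - t| <= d -> S n i.+1 - S n i <= mesh n * k) ->
  exists2 d : R, 0 < d & forall u v, t0 <= u -> u <= v ->
     `|u - t| <= d -> `|v - t| <= d -> s v - s u <= k * (v - u).
Proof.
move=> t0t [d d0 Hd]; have d20 : 0 < d / 2 by rewrite divr_gt0.
exists (d / 2) => // u v t0u uv; rewrite !ler_distl => /andP[u1 u2] /andP[v1 v2].
apply: grid_limit_increment => //.
apply: filterS2 Hd (near_mesh_small d20) => n Hn hn i /andP[ui iv].
apply: Hn; have /andP[u3 u4] := grid_indexP n t0u.
(* The grid point attached to [u] may precede it by one mesh; the other half of [d] absorbs this. *)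
have /andP[v3 v4] := grid_indexP n (le_trans t0u uv).
have h0 := mesh_gt0 n.
have : mesh n * (grid_index n u)%:R <= mesh n * i%:R by rewrite ler_pM2l// ler_nat.
have : mesh n * i%:R <= mesh n * (grid_index n v)%:R by rewrite ler_pM2l// ler_nat ltnW.
by rewrite ler_distl => ? ?; apply/andP; split; lra.
Qed.

End Limit.

Lemma grid_limit_local_norm (S : nat -> nat -> R) (s : R -> R) (m r t : R) :
  (forall t, t0 <= t -> S n (grid_index n t) @[n --> F] --> s t) -> t0 <= t ->
  (exists2 d : R, 0 < d & \forall n \near F, forall i,
     `|t0 + mesh n * i%:R - t| <= d ->
     `|S n i.+1 - S n i - mesh n * m| <= mesh n * r) ->
  exists2 d : R, 0 < d & forall u v, t0 <= u -> u <= v ->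
     `|u - t| <= d -> `|v - t| <= d -> `|s v - s u - m * (v - u)| <= r * (v - u).
Proof.
move=> cvS t0t [d d0 Hd].
have [|d1 d10 H1] := grid_limit_local cvS (k := m + r) t0t.
  exists d => //; apply: filterS Hd => n Hn i /Hn; rewrite ler_norml => /andP[_].
  lra.
have cvN t' : t0 <= t' -> - S n (grid_index n t') @[n --> F] --> - s t'.
  by move=> /cvS h; apply: cvgN.
have [|d2 d20 H2] := grid_limit_local (S := fun n i => - S n i) cvN (k := - m + r) t0t.
  exists d => //; apply: filterS Hd => n Hn i /Hn; rewrite ler_norml => /andP[+ _].
  lra.
exists (Num.min d1 d2) => [|u v t0u uv]; first by rewrite lt_min d10.
rewrite !le_min => /andP[u1 u2] /andP[v1 v2].
have := H1 u v t0u uv u1 v1; have := H2 u v t0u uv u2 v2.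
by rewrite ler_norml => ? ?; apply/andP; split; lra.
Qed.

End Grid.

(** * A viable Euler scheme *)

Section Scheme.
Context {R : realType}.
Variables (c t0 : R) (A : R -> R -> R) (B : R -> R -> R -> R).
Hypotheses (c_gt0 : 0 < c)
  (contA : continuous (fun z : R * R => A z.1 z.2))
  (contB : continuous (fun z : R * R * R => B z.1.1 z.1.2 z.2))
  (B_ge0 : forall q p t, 0 <= B q p t)
  (A0_lt0 : forall t, A 0 t < 0) (Ac_gt0 : forall t, 0 < A c t).

Definition clamp (q : R) : R := Num.max 0 (Num.min c q).

Definition bump_weight (q : R) : R := Num.max 0 (q * (c - q)).

(* [slip n q p * p] approximates the sign of [p] inside [[0, c]] and vanishes
   outside, so that friction cannot bring a trajectory back. *)
Definition slip (n : nat) (q p : R) : R :=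
  n.+1%:R * bump_weight q / (1 + n.+1%:R * bump_weight q * `|p|).

(* Friction is taken implicitly, which keeps the scheme stable although [slip]
   blows up with [n]. *)
Definition scheme_velocity (n k : nat) (z : R * R) : R :=
  let t := t0 + mesh n * k%:R in
  (z.2 + mesh n * A (clamp z.1) t) /
  (1 + mesh n * (B (clamp z.1) z.2 t * slip n z.1 z.2)).

(** The position advances with the new speed: a motion found at or beyond an end with inward speed
    was already beyond it one step earlier. *)
Fixpoint scheme (n : nat) (q0 : R) (k : nat) : R * R :=
  if k is k'.+1 then
    let z := scheme n q0 k' in
    (z.1 + mesh n * scheme_velocity n k' z, scheme_velocity n k' z)
  else (q0, 0).

Lemma clamp_id q : 0 <= q <= c -> clamp q = q.
Proof. by move=> /andP[q0 qc]; rewrite /clamp min_r// max_r. Qed.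

Lemma bump_weight_ge0 q : 0 <= bump_weight q.
Proof. by rewrite le_max lexx. Qed.

Lemma slip_den_gt0 n (q p : R) : 0 < 1 + n.+1%:R * bump_weight q * `|p|.
Proof. by rewrite ltr_pwDl// !mulr_ge0// bump_weight_ge0. Qed.

Lemma slip_ge0 n q p : 0 <= slip n q p.
Proof.
by apply: divr_ge0; [rewrite mulr_ge0// bump_weight_ge0 | exact/ltW/slip_den_gt0].
Qed.

Lemma scheme_den_ge1 n q p t r : 1 <= 1 + mesh n * (B q p t * slip n r p).
Proof.
rewrite lerDl; apply: mulr_ge0; first exact/ltW/mesh_gt0.
by rewrite mulr_ge0// slip_ge0.
Qed.

Lemma scheme_den_gt0 n q p t r : 0 < 1 + mesh n * (B q p t * slip n r p).
Proof. exact: lt_le_trans (scheme_den_ge1 _ _ _ _ _). Qed.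

Lemma scheme_continuous n k : continuous (fun q0 => scheme n q0 k).
Proof.
elim: k => [|k IH] /=; first by continuity.
have cc : continuous (fun q0 => clamp (scheme n q0 k).1).
  by rewrite /clamp; continuity.
have cw : continuous (fun q0 => bump_weight (scheme n q0 k).1).
  by rewrite /bump_weight; continuity.
have cs : continuous (fun q0 => slip n (scheme n q0 k).1 (scheme n q0 k).2).
  rewrite /slip; apply: continuous_mul; first by continuity.
  apply: continuous_inv; last by continuity.
  by move=> q; rewrite gt_eqF// slip_den_gt0.
pose t := t0 + mesh n * k%:R.
have cA : continuous (fun q0 => A (clamp (scheme n q0 k).1) t).
  have h : continuous (fun q0 => (clamp (scheme n q0 k).1, t)) by continuity.
  exact: (continuous_comp_fun h contA).
have cB : continuous (fun q0 => B (clamp (scheme n q0 k).1) (scheme n q0 k).2 t).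
  have h : continuous (fun q0 => (clamp (scheme n q0 k).1, (scheme n q0 k).2, t)).
    by continuity.
  exact: (continuous_comp_fun h contB).
have cv : continuous (fun q0 => scheme_velocity n k (scheme n q0 k)).
  rewrite /scheme_velocity -/t /=.
  apply: continuous_mul; first by continuity.
  apply: continuous_inv; last by continuity.
  by move=> q; rewrite gt_eqF// scheme_den_gt0.
by continuity.
Qed.

Lemma scheme_exit_right n q0 k :
  c <= (scheme n q0 k).1 -> c < (scheme n q0 k.+1).1.
Proof.
have h0 := @mesh_gt0 R n.
have vel j : c <= (scheme n q0 j).1 -> 0 <= (scheme n q0 j).2 ->
    0 < (scheme n q0 j.+1).2.
  move=> cq p0; rewrite /= divr_gt0 ?scheme_den_gt0//.
  by rewrite ltr_wpDl// mulr_gt0// /clamp min_l// max_r ?ltW.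
have nneg j : c <= (scheme n q0 j).1 -> 0 <= (scheme n q0 j).2.
  elim: j => [//|j IH] cq; rewrite leNgt; apply/negP => vlt.
  have cqj : c <= (scheme n q0 j).1.
    move: cq vlt; rewrite /=; set v := scheme_velocity _ _ _ => cq vlt.
    have : mesh n * v <= 0 by rewrite mulr_ge0_le0// ltW.
    lra.
  by have := vel j cqj (IH cqj); rewrite ltNge (ltW vlt).
move=> cq; rewrite /= ltr_pwDr// mulr_gt0//.
exact: (vel k cq (nneg k cq)).
Qed.

Lemma scheme_exit_left n q0 k :
  (scheme n q0 k).1 <= 0 -> (scheme n q0 k.+1).1 < 0.
Proof.
have h0 := @mesh_gt0 R n.
have vel j : (scheme n q0 j).1 <= 0 -> (scheme n q0 j).2 <= 0 ->
    (scheme n q0 j.+1).2 < 0.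
  move=> cq p0; rewrite /= /scheme_velocity nmulr_rlt0 ?invr_gt0 ?scheme_den_gt0//.
  have A0 := A0_lt0 (t0 + mesh n * j%:R).
  have -> : clamp (scheme n q0 j).1 = 0.
    by rewrite /clamp max_l// ge_min cq orbT.
  by rewrite ltr_wnDl// pmulr_rlt0.
have npos j : (scheme n q0 j).1 <= 0 -> (scheme n q0 j).2 <= 0.
  elim: j => [//|j IH] cq; rewrite leNgt; apply/negP => vlt.
  have cqj : (scheme n q0 j).1 <= 0.
    move: cq vlt; rewrite /=; set v := scheme_velocity _ _ _ => cq vlt.
    have : 0 <= mesh n * v by rewrite mulr_ge0// ltW.
    lra.
  by have := vel j cqj (IH cqj); rewrite ltNge (ltW vlt).
move=> cq; have := vel k cq (npos k cq); rewrite /= => vlt.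
have : mesh n * scheme_velocity n k (scheme n q0 k) < 0 by rewrite pmulr_rlt0.
lra.
Qed.

Lemma scheme_viable n :
  exists2 q0, 0 <= q0 <= c & forall k, 0 <= (scheme n q0 k).1 <= c.
Proof.
apply: contrapT => noviable.
pose left q0 := exists k, (scheme n q0 k).1 < 0.
pose right q0 := exists k, c < (scheme n q0 k).1.
have leftS q0 k j : (scheme n q0 k).1 < 0 -> (k <= j)%N -> (scheme n q0 j).1 < 0.
  move=> qk; elim: j => [|j IH]; first by rewrite leqn0 => /eqP<-.
  rewrite leq_eqVlt => /predU1P[<-//|]; rewrite ltnS => /IH /ltW.
  exact: scheme_exit_left.
have rightS q0 k j : c < (scheme n q0 k).1 -> (k <= j)%N -> c < (scheme n q0 j).1.
  move=> qk; elim: j => [|j IH]; first by rewrite leqn0 => /eqP<-.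
  rewrite leq_eqVlt => /predU1P[<-//|]; rewrite ltnS => /IH /ltW.
  exact: scheme_exit_right.
have notboth q0 : left q0 -> right q0 -> False.
  move=> [k hk] [j hj].
  have := leftS q0 k (maxn k j) hk (leq_maxl _ _).
  have := rightS q0 j (maxn k j) hj (leq_maxr _ _).
  by have := c_gt0; lra.
have dich q0 : 0 <= q0 <= c -> left q0 \/ right q0.
  move=> qc; apply: contrapT => /not_orP[nl nr]; apply: noviable.
  exists q0 => // k; rewrite !leNgt; apply/andP; split; apply/negP => h.
    by apply: nl; exists k.
  by apply: nr; exists k.
have c1 k : continuous (fun q0 => (scheme n q0 k).1).
  by apply: continuous_fst; exact: scheme_continuous.
have : left c.
  (* Induction over the initial angle. The angle 0 leaves on the left at the first step; this
     spreads around any angle leaving on the left, and around one leaving on the right the induction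
     hypothesis is contradictory. So [c] leaves on the left, although it leaves on the right at the
     first step. *)
  apply: (segment_ind (ltW c_gt0)).
    by exists 1%N; apply: scheme_exit_left.
  move=> q /dich[[k hk]|[k hk]].
    have /nbhs_ballP[r /= r0 Hr] : nbhs q [set x | (scheme n x k).1 < 0].
      exact: (cvgr_lt _ (c1 k q) _ hk).
    exists r => // u v _ _ u1 u2 v1 v2 _; exists k; apply: Hr.
    by rewrite /ball /= ltr_distlC; apply/andP; split; lra.
  have /nbhs_ballP[r /= r0 Hr] : nbhs q [set x | c < (scheme n x k).1].
    exact: (cvgr_gt _ (c1 k q) _ hk).
  exists r => // u v _ _ u1 u2 v1 v2 lu; exfalso; apply: (notboth u) => //.
  exists k; apply: Hr.
  by rewrite /ball /= ltr_distlC; apply/andP; split; lra.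
move=> lc; apply: (notboth c) => //; exists 1%N; exact: scheme_exit_right.
Qed.

(** On viable motions the clamp disappears, and clearing the denominator shows the implicit
    friction. The passage to the limit relies on these relations alone. *)
Lemma scheme_viable_sequences : exists Q P : nat -> nat -> R,
  [/\ forall n k, 0 <= Q n k <= c, forall n, P n 0%N = 0,
      forall n k, Q n k.+1 = Q n k + mesh n * P n k.+1 &
      forall n k, let t := t0 + mesh n * k%:R in
        P n k.+1 = P n k + mesh n *
          (A (Q n k) t - B (Q n k) (P n k) t * (slip n (Q n k) (P n k) * P n k.+1))].
Proof.
have /choice[q0 Hq0] : forall n, exists x, forall k, 0 <= (scheme n x k).1 <= c.
  by move=> n; have [x _ Hx] := scheme_viable n; exists x.
exists (fun n k => (scheme n (q0 n) k).1), (fun n k => (scheme n (q0 n) k).2).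
split=> // n k t /=; rewrite /scheme_velocity (clamp_id (Hq0 n k)) -/t.
set q := (scheme _ _ _).1; set p := (scheme _ _ _).2.
have D0 := scheme_den_gt0 n q p t q.
by field; rewrite gt_eqF.
Qed.

End Scheme.

(** * Uniform bounds for the viable discrete motions *)

Section SchemeLimit.
Context {R : realType}.
Variables (c t0 : R) (A : R -> R -> R) (B : R -> R -> R -> R).
Hypotheses (c_gt0 : 0 < c)
  (contA : continuous (fun z : R * R => A z.1 z.2))
  (contB : continuous (fun z : R * R * R => B z.1.1 z.1.2 z.2))
  (B_ge0 : forall q p t, 0 <= B q p t)
  (boundA : forall T : R, exists M : R, forall q t, t0 <= t <= T -> `|A q t| <= M)
  (boundB : forall T N : R, exists M : R, forall q p t,
     `|p| <= N -> t0 <= t <= T -> B q p t <= M).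
Variables (Q P : nat -> nat -> R).
Hypotheses (Qc : forall n k, 0 <= Q n k <= c) (P0 : forall n, P n 0%N = 0)
  (QS : forall n k, Q n k.+1 = Q n k + mesh n * P n k.+1)
  (PS : forall n k, let t := t0 + mesh n * k%:R in
    P n k.+1 = P n k + mesh n *
      (A (Q n k) t - B (Q n k) (P n k) t * (slip c n (Q n k) (P n k) * P n k.+1))).

Let time n k : R := t0 + mesh n * k%:R.
(** The discrete substitute for the sign of the speed: coefficient at the old speed, factor at the
    new one. *)
Let rho n k : R := slip c n (Q n k) (P n k) * P n k.+1.

Let time_ge n k : t0 <= time n k.
Proof. by rewrite lerDl mulr_ge0// ltW// mesh_gt0. Qed.

Lemma slip_le n (q p : R) : slip c n q p <= n.+1%:R * bump_weight c q.
Proof.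
have w0 : 0 <= n.+1%:R * bump_weight c q by rewrite mulr_ge0// bump_weight_ge0.
rewrite ler_pdivrMr ?slip_den_gt0// mulrDr mulr1 lerDl.
by rewrite mulr_ge0// mulr_ge0.
Qed.

Lemma slip_norm_le1 n (q p : R) : slip c n q p * `|p| <= 1.
Proof.
by rewrite mulrAC ler_pdivrMr ?slip_den_gt0// mul1r lerDr.
Qed.

Lemma bump_weight_le (q : R) : 0 <= q <= c -> bump_weight c q <= c ^+ 2.
Proof.
move=> /andP[q0 qc]; rewrite ge_max sqr_ge0/= expr2 ler_pM// ?subr_ge0//.
by rewrite gerBl.
Qed.

Let P_incr n k : P n k.+1 - P n k = mesh n *
  (A (Q n k) (time n k) - B (Q n k) (P n k) (time n k) * rho n k).
Proof. by rewrite {1}PS addrAC subrr add0r. Qed.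

(** Implicit friction divides the speed by [1 + d] with [d >= 0], so it drops out of the bound. *)
Let P_next_le n k : `|P n k.+1| <= `|P n k| + mesh n * `|A (Q n k) (time n k)|.
Proof.
have h0 := @mesh_gt0 R n.
set d := mesh n * (B (Q n k) (P n k) (time n k) * slip c n (Q n k) (P n k)).
have d0 : 0 <= d by apply: mulr_ge0; [exact: ltW | rewrite mulr_ge0// slip_ge0].
have e : P n k.+1 * (1 + d) = P n k + mesh n * A (Q n k) (time n k).
  by rewrite mulrDr mulr1 {1}PS /d /time; ring.
apply: (@le_trans _ _ (`|P n k.+1 * (1 + d)|)).
  by rewrite normrM ler_peMr// ger0_norm ?lerDl// addr_ge0.
by rewrite e (le_trans (ler_normD _ _))// normrM (gtr0_norm h0).
Qed.

(** With the old speed as factor the bound would be 1. The new speed adds at most [mesh n] times the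
    drift, multiplied by a slip of size at most [n.+1%:R * c ^+ 2]; the choice of the mesh turns
    this into a term of order [n.+1%:R^-1]. *)
Let rho_le n k : `|rho n k| <=
  1 + n.+1%:R^-1 * (c ^+ 2 * `|A (Q n k) (time n k)|).
Proof.
have r0 := slip_ge0 c n (Q n k) (P n k).
rewrite normrM (ger0_norm r0).
apply: (le_trans (ler_wpM2l r0 (P_next_le n k))).
rewrite mulrDr lerD ?slip_norm_le1//.
apply: (@le_trans _ _ (n.+1%:R * c ^+ 2 * (mesh n * `|A (Q n k) (time n k)|))).
  rewrite ler_wpM2r// ?mulr_ge0 ?(ltW (mesh_gt0 _))//.
  by rewrite (le_trans (slip_le _ _ _))// ler_wpM2l// bump_weight_le.
by rewrite -mesh_natr le_eqVlt; apply/orP; left; apply/eqP; ring.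
Qed.

Let P_bound (T : R) : exists2 N : R, 0 <= N & forall n k, time n k <= T -> `|P n k| <= N.
Proof.
have [M HM] := boundA T.
have [Tt0|t0T] := ltP T t0.
  by exists 0 => // n k /(le_trans (time_ge n k)); rewrite leNgt Tt0.
have M0 : 0 <= M by apply: le_trans (HM 0 t0 _); rewrite ?lexx.
exists (M * (T - t0)) => [|n k]; first by rewrite mulr_ge0// subr_ge0.
have h0 := @mesh_gt0 R n.
suff : time n k <= T -> `|P n k| <= M * (mesh n * k%:R).
  by move=> H tT; rewrite (le_trans (H tT))// ler_wpM2l//; move: tT; rewrite /time; lra.
elim: k => [_|k IH]; first by rewrite P0 normr0 !mulr0.
rewrite {1}/time -natr1 => tT.
have tkT : time n k <= T by move: tT; rewrite /time; lra.
apply: (le_trans (P_next_le n k)).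
have := ler_wpM2l (ltW h0) (HM (Q n k) (time n k) _).
rewrite time_ge tkT => /(_ isT) h; have := IH tkT; lra.
Qed.

Let PQ_lipschitz (T : R) : exists2 L : R, 0 < L & forall n k, time n k <= T ->
  `|P n k.+1 - P n k| <= mesh n * L /\ `|Q n k.+1 - Q n k| <= mesh n * L.
Proof.
have [M HM] := boundA T; have [N N0 HN] := P_bound T.
have [M' HM'] := boundB T N.
(* Drift, friction times the bound on [rho] (with [n.+1%:R^-1 <= 1]), and speed: none depends on
   [n]. *)
pose L := `|M| + `|M'| * (1 + c ^+ 2 * `|M|) + N + 1.
exists L => [|n k tT].
  rewrite ltr_wpDl// addr_ge0// addr_ge0// mulr_ge0// addr_ge0// mulr_ge0//.
  exact: sqr_ge0.
have h0 := @mesh_gt0 R n.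
have tkT : t0 <= time n k <= T by rewrite time_ge.
have Ak : `|A (Q n k) (time n k)| <= `|M|.
  by rewrite (le_trans (HM _ _ tkT))// ler_norm.
have Bk : `|B (Q n k) (P n k) (time n k)| <= `|M'|.
  by rewrite ger0_norm// (le_trans (HM' _ _ _ _ tkT)) ?HN// ler_norm.
have n1 : (n.+1%:R^-1 : R) <= 1 by rewrite invf_le1// ler1n.
have c20 : 0 <= c ^+ 2 * `|A (Q n k) (time n k)| by rewrite mulr_ge0// sqr_ge0.
have rk : `|rho n k| <= 1 + c ^+ 2 * `|M|.
  rewrite (le_trans (rho_le n k))// lerD2l.
  by rewrite (le_trans (ler_wpM2r c20 n1))// mul1r ler_wpM2l// sqr_ge0.
have m1 : mesh n <= 1 :> R.
  by rewrite invf_le1 ?exprn_gt0// -natrX ler1n expn_gt0.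
split.
  rewrite P_incr normrM (gtr0_norm h0) ler_pM2l//.
  apply: (le_trans (ler_normB _ _)).
  have := ler_pM (normr_ge0 _) (normr_ge0 _) Bk rk.
  rewrite -normrM /L; lra.
rewrite QS addrAC subrr add0r normrM (gtr0_norm h0) ler_pM2l//.
rewrite (le_trans (P_next_le n k))//.
have : mesh n * `|A (Q n k) (time n k)| <= `|M|.
  by rewrite -[leRHS]mul1r ler_pM// ltW.
have := HN _ _ tT.
have : 0 <= `|M'| * (1 + c ^+ 2 * `|M|) by rewrite mulr_ge0// addr_ge0// mulr_ge0// sqr_ge0.
rewrite /L; lra.
Qed.

(** * Local estimates for the limit along an ultrafilter *)

Section UltraLimit.
Variables (F : set_system nat).
Hypotheses (UF : UltraFilter F) (ooF : \oo `<=` F).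

Let time_index n t : t0 <= t -> time n (grid_index t0 n t) <= t.
Proof. by move=> /(grid_indexP n)/andP[h _]; rewrite /time; lra. Qed.

Lemma scheme_ultralimit t : t0 <= t -> exists z : R * R,
  Q n (grid_index t0 n t) @[n --> F] --> z.1 /\
  P n (grid_index t0 n t) @[n --> F] --> z.2.
Proof.
move=> t0t; have [N _ HN] := P_bound t.
have [x cx] := @ultra_bounded_cvg R F (fun n => Q n (grid_index t0 n t)) c UF
  (fun n => ltac:(by rewrite ger0_norm; case/andP: (Qc n (grid_index t0 n t)))).
have [y cy] := @ultra_bounded_cvg R F (fun n => P n (grid_index t0 n t)) N UF
  (fun n => HN _ _ (time_index n t0t)).
by exists (x, y).
Qed.

Variables q p : R -> R.
Hypotheses
  (cvgQ : forall t, t0 <= t -> Q n (grid_index t0 n t) @[n --> F] --> q t)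
  (cvgP : forall t, t0 <= t -> P n (grid_index t0 n t) @[n --> F] --> p t).

Let FF : ProperFilter F := @ultra_proper _ _ UF.

Lemma limit_q_bounds t : t0 <= t -> 0 <= q t <= c.
Proof.
move=> /cvgQ h; apply/andP; split.
  by apply: (cvgr_to_ge h); apply: nearW => n; case/andP: (Qc n (grid_index t0 n t)).
by apply: (cvgr_to_le h); apply: nearW => n; case/andP: (Qc n (grid_index t0 n t)).
Qed.

Lemma limit_p_start : p t0 = 0.
Proof.
apply/esym/(cvg_unique _ _ (cvgP (lexx t0))) => //.
have -> : (fun n => P n (grid_index t0 n t0)) = (fun=> 0).
  by apply/funext => n; rewrite /grid_index subrr mul0r truncn0 P0.
exact: cvg_cst.
Qed.

(** Convergence is known only at the single time [t]; the Lipschitz bound, uniform in [n], extends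
    it to all grid times near [t]. *)
Let near_state (t e : R) : t0 <= t -> 0 < e -> exists2 d : R, 0 < d &
  \forall n \near F, forall k, `|time n k - t| <= d ->
    `|Q n k - q t| <= e /\ `|P n k - p t| <= e.
Proof.
move=> t0t e0; have [L L0 HL] := PQ_lipschitz (t + 1).
(* Two grid times within [d] of [t] are at most [2 * d] apart, which costs [e / 2]; [d <= 1] keeps
   the times before [t + 1], where [L] is valid. *)
pose d := Num.min 1 (e / (4 * L)).
have d0 : 0 < d by rewrite lt_min ltr01 divr_gt0// mulr_gt0.
have dL : L * (d + d) <= e / 2.
  have : d <= e / (4 * L) by rewrite ge_min lexx orbT.
  rewrite ler_pdivlMr ?mulr_gt0//; lra.
have d1 : d <= 1 by rewrite ge_min lexx.
exists d => //; have e20 : 0 < e / 2 by rewrite divr_gt0.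
have /cvgrPdist_le/(_ _ e20) HQ := cvgQ t0t.
have /cvgrPdist_le/(_ _ e20) HP := cvgP t0t.
apply: filterS3 HQ HP (near_mesh_small FF ooF d0) => n Qn Pn hn k kd.
set K := grid_index t0 n t in Qn Pn.
have h0 := @mesh_gt0 R n.
have Kd : `|time n K - t| <= d.
  have /andP[K1 K2] := grid_indexP n t0t; rewrite -/K in K1 K2.
  by rewrite ler_norml /time; apply/andP; split; lra.
have tJ j : (j < maxn k K)%N -> time n j <= t + 1.
  have mono i : (j <= i)%N -> time n j <= time n i.
    by move=> ji; rewrite lerD2l ler_pM2l// ler_nat.
  move: kd Kd; rewrite !ler_norml leq_max => /andP[_ k1] /andP[_ k2].
  by move=> /orP[/ltnW/mono|/ltnW/mono]; lra.
have kK : `|k%:R - K%:R| * mesh n <= d + d.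
  rewrite -[X in _ * X]gtr0_norm// -normrM.
  have -> : (k%:R - K%:R) * mesh n = (time n k - t) - (time n K - t).
    by rewrite /time; ring.
  by rewrite (le_trans (ler_normB _ _))// lerD.
have incr (s : nat -> R) l : (forall j, time n j <= t + 1 ->
    `|s j.+1 - s j| <= mesh n * L) -> `|l - s K| <= e / 2 -> `|s k - l| <= e.
  move=> Hs lK; rewrite -(subrKA (s K)) (le_trans (ler_normD _ _))//.
  have h := @increment_norm_le R s (mesh n * L) (maxn k K) (fun j jJ => Hs j (tJ j jJ))
    k K (leq_maxl _ _) (leq_maxr _ _).
  have h2 := ler_wpM2l (ltW L0) kK.
  rewrite [`|s K - l|]distrC; lra.
by split; apply: incr => // j /HL[].
Qed.

Let near_coeff (t e : R) : t0 <= t -> 0 < e -> exists2 d : R, 0 < d &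
  \forall n \near F, forall k, `|time n k - t| <= d ->
    `|A (Q n k) (time n k) - A (q t) t| <= e /\
    `|B (Q n k) (P n k) (time n k) - B (q t) (p t) t| <= e.
Proof.
move=> t0t e0.
have := @contA (q t, t).
move=> /cvgrPdist_le/(_ _ e0)/nbhs_ballP[r /= r0 Hr].
have := @contB (q t, p t, t).
move=> /cvgrPdist_le/(_ _ e0)/nbhs_ballP[r' /= r'0 Hr'].
pose m := Num.min r r' / 2.
have m0 : 0 < m by rewrite divr_gt0// lt_min r0.
have mr : m < r /\ m < r'.
  have : Num.min r r' <= r /\ Num.min r r' <= r' by rewrite !ge_min !lexx orbT.
  by rewrite /m => -[? ?]; move: m0; rewrite /m => ?; split; lra.
have [d d0 Hd] := near_state t0t m0.
exists (Num.min d m) => [|]; first by rewrite lt_min d0.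
apply: filterS Hd => n Hn k; rewrite le_min => /andP[kd km].
have [Hq Hp] := Hn k kd; have [mr1 mr2] := mr.
split; rewrite distrC.
  apply: (Hr (Q n k, time n k)); split=> /=; rewrite /ball /= distrC;
    exact: le_lt_trans mr1.
apply: (Hr' (Q n k, P n k, time n k)); (split; [split|]) => /=; rewrite /ball /= distrC;
  exact: le_lt_trans mr2.
Qed.

Let near_rho_le (t e : R) : t0 <= t -> 0 < e ->
  \forall n \near F, forall k, `|time n k - t| <= 1 -> `|rho n k| <= 1 + e.
Proof.
move=> t0t e0; have [M HM] := boundA (t + 1).
have K0 : 0 < c ^+ 2 * `|M| + 1 by rewrite ltr_wpDl// mulr_ge0// sqr_ge0.
apply: filterS (near_inv_small ooF (divr_gt0 e0 K0)) => n.
rewrite ler_pdivlMr// => Hn k; rewrite ler_norml => /andP[_ k1].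
apply: (le_trans (rho_le n k)); rewrite lerD2l; apply: le_trans Hn.
rewrite ler_wpM2l ?invr_ge0// (@le_trans _ _ (c ^+ 2 * `|M|)) ?lerDl//.
rewrite ler_wpM2l ?sqr_ge0// (le_trans (HM _ _ _)) ?ler_norm// time_ge /=; lra.
Qed.

(** With [x] the product of [n.+1%:R], the weight and the old speed in absolute value, the
    regularized sign is the true sign times [x / (1 + x)]. Since the weight and the speed stay away
    from 0 near [t], [x] grows at least like [n.+1%:R]. *)
Let near_rho_sgn (t e : R) : t0 <= t -> 0 < e -> p t != 0 -> 0 < q t < c ->
  exists2 d : R, 0 < d & \forall n \near F, forall k, `|time n k - t| <= d ->
    `|rho n k - Num.sg (p t)| <= e.
Proof.
move=> t0t e0 pt0 /andP[qt0 qtc].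
have [L L0 HL] := PQ_lipschitz (t + 1).
have np0 : 0 < `|p t| by rewrite normr_gt0.
pose w := q t * (c - q t).
have w0 : 0 < w by rewrite mulr_gt0// subr_gt0.
(* This closeness keeps the sign of the speed, at least half its size, and at least half the
   weight. *)
pose m := Num.min (`|p t| / 2) (w / (2 * c)).
have m0 : 0 < m by rewrite lt_min !divr_gt0// mulr_gt0.
have mp : m <= `|p t| / 2 by rewrite ge_min lexx.
have mw : m * c <= w / 2.
  have : m <= w / (2 * c) by rewrite ge_min lexx orbT.
  rewrite ler_pdivlMr ?mulr_gt0//; lra.
pose kappa := w / 2 * (`|p t| / 2).
have kappa0 : 0 < kappa by rewrite mulr_gt0// divr_gt0.
(* The first term is the error of the regularized sign, the second that of using the new speed; both
   are divided by [n.+1%:R]. *)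
pose K := kappa^-1 + c ^+ 2 * L.
have K0 : 0 < K by rewrite addr_gt0 ?invr_gt0// mulr_gt0// exprn_gt0.
have [d d0 Hd] := near_state t0t m0.
exists (Num.min d 1); first by rewrite lt_min d0 ltr01.
apply: filterS2 Hd (near_inv_small ooF (divr_gt0 e0 K0)) => n Hn.
rewrite ler_pdivlMr// => nK k; rewrite le_min => /andP[kd k1].
have [Hq Hp] := Hn k kd.
apply: le_trans nK.
have tk1 : time n k <= t + 1 by move: k1; rewrite ler_norml => /andP[_]; lra.
have [HP _] := HL n k tk1.
set s := slip c n (Q n k) (P n k).
have s0 : 0 <= s by exact: slip_ge0.
have -> : rho n k - Num.sg (p t) =
    (s * P n k - Num.sg (p t)) + s * (P n k.+1 - P n k) by rewrite /rho -/s; ring.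
rewrite (le_trans (ler_normD _ _))// [leRHS]mulrDr lerD//; last first.
  rewrite normrM (ger0_norm s0).
  apply: (@le_trans _ _ (n.+1%:R * c ^+ 2 * (mesh n * L))).
    rewrite ler_pM// (le_trans (slip_le _ _ _))// ler_wpM2l// bump_weight_le//.
  by rewrite -mesh_natr le_eqVlt; apply/orP; left; apply/eqP; ring.
have Psg : P n k = Num.sg (p t) * `|P n k|.
  move: Hp mp; rewrite ler_norml => /andP[h1 h2].
  case: (ltgtP (p t) 0) pt0 => // pt _.
    rewrite ltr0_norm// => h3; rewrite ltr0_sg// ltr0_norm ?mulN1r ?opprK//; lra.
  by rewrite gtr0_norm// => h3; rewrite gtr0_sg// gtr0_norm ?mul1r//; lra.
have Pm : `|p t| / 2 <= `|P n k|.
  have := ler_dist_dist (p t) (P n k); rewrite [`|p t - _|]distrC => /(le_trans (ler_norm _)).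
  lra.
have wQ : w / 2 <= bump_weight c (Q n k).
  rewrite /bump_weight le_max; apply/orP; right.
  have /andP[Q0 Q1] := Qc n k.
  have h : `|(Q n k - q t) * (c - Q n k - q t)| <= m * c.
    by rewrite normrM ler_pM// ler_norml; apply/andP; split; lra.
  have e1 : Q n k * (c - Q n k) = w + (Q n k - q t) * (c - Q n k - q t).
    by rewrite /w; ring.
  by move: h; rewrite e1 ler_norml => /andP[h _]; lra.
set x := n.+1%:R * bump_weight c (Q n k) * `|P n k|.
have xk : n.+1%:R * kappa <= x.
  rewrite /x -[leRHS]mulrA ler_wpM2l// ler_pM// divr_ge0//.
  exact: ltW.
have x0 : 0 < 1 + x by exact: slip_den_gt0.
have -> : s * P n k - Num.sg (p t) = - Num.sg (p t) / (1 + x).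
  have -> : s * P n k = Num.sg (p t) * (x / (1 + x)).
    by rewrite {1}Psg /s /slip -/x /x; ring.
  by field; rewrite gt_eqF.
rewrite normrM normrN normr_sg pt0 mul1r normfV gtr0_norm// -invfM.
rewrite lef_pV2 ?posrE// ?mulr_gt0//; lra.
Qed.

Lemma limit_q_incr (t e : R) : t0 <= t -> 0 < e -> exists2 d : R, 0 < d &
  forall u v, t0 <= u -> u <= v -> `|u - t| <= d -> `|v - t| <= d ->
    `|q v - q u - p t * (v - u)| <= e * (v - u).
Proof.
move=> t0t e0; apply: (grid_limit_local_norm FF ooF cvgQ t0t).
have [d d0 Hd] := near_state t0t e0.
(* The increment of [Q] uses the next speed, whose grid time is one mesh later; hence the reserve
   [d / 2]. *)
have d20 : 0 < d / 2 by rewrite divr_gt0.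
exists (d / 2) => //.
apply: filterS2 Hd (near_mesh_small FF ooF d20) => n Hn hn k kd.
have h0 := @mesh_gt0 R n.
have [|_ HP] := Hn k.+1.
  rewrite /time -natr1; move: kd; rewrite !ler_norml => /andP[h1 h2].
  by apply/andP; split; lra.
rewrite QS (_ : _ - _ - _ = mesh n * (P n k.+1 - p t)); last by ring.
by rewrite normrM gtr0_norm// ler_pM2l.
Qed.

(** Valid whatever the sign of the speed, because only the bound on [rho] enters; it is applied on
    the zero set of [p]. *)
Lemma limit_p_incr (t e : R) : t0 <= t -> 0 < e -> exists2 d : R, 0 < d &
  forall u v, t0 <= u -> u <= v -> `|u - t| <= d -> `|v - t| <= d ->
    `|p v - p u - A (q t) t * (v - u)| <= (B (q t) (p t) t + e) * (v - u).
Proof.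
move=> t0t e0; apply: (grid_limit_local_norm FF ooF cvgP t0t).
set a := A _ _; set b := B _ _ _.
have b0 : 0 <= b by exact: B_ge0.
have b3 : 0 < b + 3 by rewrite ltr_wpDl.
(* For [r <= 1], [r + (b + r) * (1 + r) <= b + r * (b + 3)]. *)
pose r := Num.min 1 (e / (b + 3)).
have r0 : 0 < r by rewrite lt_min ltr01 divr_gt0.
have r1 : r <= 1 by rewrite ge_min lexx.
have re : r * (b + 3) <= e by rewrite -ler_pdivlMr// ge_min lexx orbT.
have [d d0 Hd] := near_coeff t0t r0.
exists (Num.min d 1); first by rewrite lt_min d0 ltr01.
apply: filterS2 Hd (near_rho_le t0t r0) => n Hn Hrho k; rewrite le_min => /andP[kd k1].
have [HA HB] := Hn k kd; have {}Hrho := Hrho k k1.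
rewrite P_incr -mulrBr normrM gtr0_norm ?mesh_gt0// ler_pM2l ?mesh_gt0//.
set Ak := A _ _ in HA *; set Bk := B _ _ _ in HB *.
rewrite addrAC (le_trans (ler_normB _ _))//.
have Bb : `|Bk| <= b + r.
  rewrite -(subrKC b Bk) (le_trans (ler_normD _ _))// ger0_norm// lerD2l.
  by [].
have : `|Bk * rho n k| <= (b + r) * (1 + r) by rewrite normrM ler_pM.
have : r * r <= r by rewrite ger_pMl.
move: HA; rewrite -/a; lra.
Qed.

Lemma limit_p_incr_sgn (t e : R) : t0 <= t -> 0 < e -> p t != 0 -> 0 < q t < c ->
  exists2 d : R, 0 < d &
  forall u v, t0 <= u -> u <= v -> `|u - t| <= d -> `|v - t| <= d ->
    `|p v - p u - (A (q t) t - B (q t) (p t) t * Num.sg (p t)) * (v - u)|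
    <= e * (v - u).
Proof.
move=> t0t e0 pt0 qt; apply: (grid_limit_local_norm FF ooF cvgP t0t).
set a := A _ _; set b := B _ _ _; set s := Num.sg _.
have s1 : `|s| = 1 by rewrite normr_sg pt0.
have b0 : 0 <= b by exact: B_ge0.
have b3 : 0 < b + 3 by rewrite ltr_wpDl.
pose r := Num.min 1 (e / (b + 3)).
have r0 : 0 < r by rewrite lt_min ltr01 divr_gt0.
have r1 : r <= 1 by rewrite ge_min lexx.
have re : r * (b + 3) <= e by rewrite -ler_pdivlMr// ge_min lexx orbT.
have [d d0 Hd] := near_coeff t0t r0.
have [d' d'0 Hd'] := near_rho_sgn t0t r0 pt0 qt.
exists (Num.min d d'); first by rewrite lt_min d0.
apply: filterS2 Hd Hd' => n Hn Hrho k; rewrite le_min => /andP[kd kd'].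
have [HA HB] := Hn k kd; have {}Hrho := Hrho k kd'.
rewrite P_incr -mulrBr normrM gtr0_norm ?mesh_gt0// ler_pM2l ?mesh_gt0//.
set Ak := A _ _ in HA *; set Bk := B _ _ _ in HB *.
have -> : Ak - Bk * rho n k - (a - b * s) =
  (Ak - a) - (Bk * (rho n k - s) + (Bk - b) * s) by ring.
rewrite (le_trans (ler_normB _ _))//.
have Bb : `|Bk| <= b + r.
  rewrite -(subrKC b Bk) (le_trans (ler_normD _ _))// ger0_norm// lerD2l.
  by [].
have h1 : `|Bk * (rho n k - s)| <= (b + r) * r by rewrite normrM ler_pM.
have h2 : `|(Bk - b) * s| <= r by rewrite normrM s1 mulr1.
have := ler_normD (Bk * (rho n k - s)) ((Bk - b) * s).
have : r * r <= r by rewrite ger_pMl.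
move: HA; rewrite -/a; lra.
Qed.

Lemma limit_lipschitz (T : R) : exists2 L : R, 0 < L &
  forall u v, t0 <= u -> u <= v -> v <= T ->
    `|q v - q u| <= L * (v - u) /\ `|p v - p u| <= L * (v - u).
Proof.
have [L L0 HL] := PQ_lipschitz T; exists L => // u v t0u uv vT.
have tT n k : (k < grid_index t0 n v)%N -> time n k <= T.
  move=> kv; apply: le_trans vT; apply: le_trans (time_index n (le_trans t0u uv)).
  by rewrite lerD2l ler_pM2l ?mesh_gt0// ler_nat ltnW.
have cvN (S : nat -> nat -> R) s :
    (forall t, t0 <= t -> S n (grid_index t0 n t) @[n --> F] --> s t) ->
    forall t, t0 <= t -> - S n (grid_index t0 n t) @[n --> F] --> - s t.
  by move=> h t /h ?; apply: cvgN.
have incr (S : nat -> nat -> R) s :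
    (forall t, t0 <= t -> S n (grid_index t0 n t) @[n --> F] --> s t) ->
    (forall n k, time n k <= T -> `|S n k.+1 - S n k| <= mesh n * L) ->
    `|s v - s u| <= L * (v - u).
  move=> cS HS.
  have h1 : s v - s u <= L * (v - u).
    apply: (grid_limit_increment FF ooF cS) => //; apply: nearW => n k /andP[_ /tT/HS].
    exact/le_trans/ler_norm.
  have h2 : - s v - - s u <= L * (v - u).
    apply: (grid_limit_increment (S := fun n k => - S n k) FF ooF (cvN _ _ cS)) => //.
    apply: nearW => n k /andP[_ /tT/HS]; apply: le_trans.
    by rewrite -opprD -normrN ler_norm.
  by rewrite ler_norml; apply/andP; split; lra.
by split; [apply: incr cvgQ _ | apply: incr cvgP _] => n k /HL[].
Qed.

End UltraLimit.
End SchemeLimit.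

(** * Derivatives of the limit *)

(** Otherwise [A] misses a ball of radius [e] times the size of [h] inside the ball around [t] of
    radius [1 + e] times that size. Its share of the large ball is then at most [1 / (1 + e)], which
    is excluded close to a density point. *)
Lemma density_point_close (R : realType) (A : set R) : measurable A ->
  {ae @lebesgue_measure R, forall t, A t -> forall e : R, 0 < e ->
    exists2 d : R, 0 < d & forall h, `|h| < d ->
      exists2 z, A z & `|t + h - z| <= e * `|h|}.
Proof.
move=> mA; apply: negligibleS (lebesgue_density mA) => t /=.
apply: contra_not => dens At e e0.
have e10 : 0 < 1 + e by rewrite addr_gt0.
pose eta := e / (1 + e).
have eta1 : 1 - eta = (1 + e)^-1 by rewrite /eta; field; rewrite gt_eqF.
have nb : nbhs ((\1_A t)%:E : \bar R) [set y | ((1 - eta)%:E < y)%E].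
  apply: open_nbhs_nbhs; split; first exact: open_ereal_gt_ereal.
  by rewrite /= indicE mem_set//= lte_fin eta1 invf_lt1// ltrDl.
have := dens _ nb.
rewrite /fmap /= /at_right /within /= => /nbhs_ballP[d /= d0 Hd].
exists (d / (1 + e)) => [|h]; first by rewrite divr_gt0.
rewrite ltr_pdivlMr// => hd.
have [->|h0] := eqVneq h 0; first by exists t; rewrite ?addr0 ?subrr ?normr0 ?mulr0.
apply: contrapT => noz.
have nh : 0 < `|h| by rewrite normr_gt0.
pose r := (1 + e) * `|h|.
have r0 : 0 < r by rewrite mulr_gt0.
have er0 : 0 < e * `|h| by rewrite mulr_gt0.
have rd : r < d by rewrite /r mulrC.
have := Hd r; rewrite /ball /= sub0r normrN (gtr0_norm r0).
move=> /(_ rd r0).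
rewrite lebesgue_measure_ball ?ltW// inver mulrn_eq0 /= gt_eqF//.
rewrite lte_pdivlMr ?mulrn_wgt0// -EFinM eta1 => lower.
have mball (x s : R) : measurable (ball x s) by rewrite ball_itv; exact: measurable_itv.
pose S := ball (t + h) (e * `|h|).
have mS : measurable S by exact: mball.
have mAb : measurable (A `&` ball t r).
  exact: measurableI.
have disj : (A `&` ball t r) `&` S = set0.
  apply/seteqP; split=> z //= -[[Az _] Sz]; apply: noz; exists z => //.
  exact: ltW.
have sub : (A `&` ball t r) `|` S `<=` ball t r.
  move=> z [[]//|]; rewrite /S /ball /= => hz.
  have -> : t - z = (t + h - z) - h by ring.
  rewrite (le_lt_trans (ler_normB _ _))// /r mulrDl mul1r addrC ltrD2l//.
have := @le_measure _ _ _ (@lebesgue_measure R) _ _ _ _ sub.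
rewrite !inE => /(_ (measurableU _ _ mAb mS) (mball _ _)).
rewrite measureU//= (lebesgue_measure_ball _ (ltW r0)) (lebesgue_measure_ball _ (ltW er0)) => upper.
move: lower upper; case: (lebesgue_measure _) => [m| |].
- rewrite lte_fin -EFinD lee_fin => h1 h2.
  have : (1 + e)^-1 * (r *+ 2) = `|h| *+ 2.
    by rewrite /r -mulrnAr mulKf// gt_eqF.
  by move: h1 h2; rewrite /r mulrDl mul1r; lra.
- by rewrite addye// leye_eq.
- by rewrite ltNge leNye.
Qed.

Lemma is_derive_of_increments (R : realType) (f : R -> R) (t0 t m : R) : t0 < t ->
  (forall e : R, 0 < e -> exists2 d : R, 0 < d &
     forall u v, t0 <= u -> u <= v -> `|u - t| <= d -> `|v - t| <= d ->
       `|f v - f u - m * (v - u)| <= e * (v - u)) ->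
  is_derive t 1 f m.
Proof.
move=> t0t H; apply/is_deriveP => e /H[d d0 Hd].
exists (Num.min d (t - t0)) => [|h]; first by rewrite lt_min d0 subr_gt0.
rewrite lt_min => /andP[hd ht]; rewrite /GRing.scale /=.
have tt : `|t - t| <= d by rewrite subrr normr0 ltW.
have th : `|t + h - t| <= d by rewrite addrAC subrr add0r ltW.
have [h0|h0] := leP 0 h.
  have := Hd t (t + h) (ltW t0t) _ tt th; rewrite lerDl h0 => /(_ isT).
  have -> : t + h - t = h by ring.
  by rewrite [m * h]mulrC (ger0_norm h0).
rewrite (ltr0_norm h0) in ht *.
have h1 : t0 <= t + h by lra.
have h2 : t + h <= t by lra.
have := Hd (t + h) t h1 h2 th tt.
have -> : t - (t + h) = - h by ring.
have -> : f t - f (t + h) - m * - h = - (f (t + h) - f t - h * m) by ring.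
by rewrite normrN.
Qed.

(** At a density point [t] of the zero set, [t + h] has a zero at distance [o(h)], and the Lipschitz
    bound gives [f (t + h) = o(h)]. *)
Lemma is_derive_zeros (R : realType) (f : R -> R) (t0 : R) :
  (forall T : R, exists2 L : R, 0 < L & forall u v, t0 <= u -> u <= v -> v <= T ->
     `|f v - f u| <= L * (v - u)) ->
  {ae @lebesgue_measure R, forall t, t0 < t -> f t = 0 -> is_derive t 1 f 0}.
Proof.
(* Freezing [f] before [t0] gives a function continuous on the whole line, whose zero set is closed,
   hence measurable. *)
move=> lipf; pose g s := f (Num.max t0 s).
have lipg T : exists2 L : R, 0 < L & forall x y, x <= T -> y <= T ->
    `|g x - g y| <= L * `|x - y|.
  have [L L0 HL] := lipf (Num.max t0 T); exists L => // x y.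
  wlog yx : x y / y <= x.
    move=> W xT yT; have [yx|/ltW xy] := leP y x; first exact: W.
    by rewrite distrC [`|x - _|]distrC; exact: W.
  move=> xT yT.
  have := HL (Num.max t0 y) (Num.max t0 x).
  rewrite le_max lexx /= => /(_ isT).
  have h : Num.max t0 y <= Num.max t0 x by rewrite ge_max !le_max lexx yx orbT.
  have h' : Num.max t0 x <= Num.max t0 T by rewrite ge_max !le_max lexx xT orbT.
  move=> /(_ h h') /le_trans; apply; rewrite ler_pM2l// ger0_norm ?subr_ge0//.
  rewrite /Num.max; case: ltP => h1; case: ltP => h2; lra.
have cg : continuous g.
  move=> x; apply/cvgrPdist_le => e e0.
  have [L L0 HL] := lipg (x + 1).
  have r0 : 0 < Num.min 1 (e / L) by rewrite lt_min ltr01 divr_gt0.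
  apply/nbhs_ballP; exists (Num.min 1 (e / L)) => //= y.
  rewrite /ball /= lt_min ltr_pdivlMr// => /andP[xy1 xye].
  rewrite (le_trans (HL x y _ _)) ?lerDl//; last by rewrite mulrC ltW.
  by move: xy1; rewrite ltr_distlC => /andP[]; lra.
have mZ := measurable_realfun.closed_measurable (closed_zeros cg).
apply: negligibleS (density_point_close mZ) => t /=.
apply: contra_not => dens t0t ft0; apply/is_deriveP => e e0.
have gE s : t0 <= s -> g s = f s by move=> h; rewrite /g max_r.
have [L L0 HL] := lipg (t + 1).
have r0 : 0 < Num.min 1 (e / L) by rewrite lt_min ltr01 divr_gt0.
have [|d d0 Hd] := dens _ _ r0; first by rewrite gE// ltW.
(* With [h] below [1 / 2], both [t + h] and the zero near it stay before [t + 1], where [L] is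
   valid. *)
exists (Num.min d (Num.min (1 / 2) (t - t0))) => [|h].
  by rewrite !lt_min d0 divr_gt0//= subr_gt0.
rewrite !lt_min => /and3P[hd h1 h2].
have [z gz tz] := Hd h hd.
have hh := ler_norm h; have hh' := ler_norm (- h); rewrite normrN in hh'.
rewrite scaler0 subr0 ft0 subr0 -gE; last by lra.
have e1 : Num.min 1 (e / L) * `|h| <= 1 * `|h| by rewrite ler_wpM2r// ge_min lexx.
have e2 : Num.min 1 (e / L) * `|h| <= e / L * `|h|.
  by rewrite ler_wpM2r// ge_min lexx orbT.
rewrite -[g _]subr0 -gz (le_trans (HL _ _ _ _))//.
- by lra.
- by have := ler_norm (- (t + h - z)); rewrite normrN; lra.
- rewrite -ler_pdivlMl// mulrC mulrAC; exact: le_trans tz e2.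
Qed.

(** * Existence of a viable motion under general drift and friction *)

Section Viability.
Context {R : realType}.
Variables (c t0 : R) (A : R -> R -> R) (B : R -> R -> R -> R).
Hypotheses (c_gt0 : 0 < c)
  (contA : continuous (fun z : R * R => A z.1 z.2))
  (contB : continuous (fun z : R * R * R => B z.1.1 z.1.2 z.2))
  (B_ge0 : forall q p t, 0 <= B q p t)
  (A0_lt0 : forall t, A 0 t < 0) (Ac_gt0 : forall t, 0 < A c t)
  (boundA : forall T : R, exists M : R, forall q t, t0 <= t <= T -> `|A q t| <= M)
  (boundB : forall T N : R, exists M : R, forall q p t,
     `|p| <= N -> t0 <= t <= T -> B q p t <= M).

Lemma dry_friction_viable : exists q p : R -> R,
  [/\ forall t, t0 <= t -> 0 <= q t <= c, p t0 = 0,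
      forall T : R, exists2 L : R, 0 < L &
        forall u v, t0 <= u -> u <= v -> v <= T ->
        `|q v - q u| <= L * (v - u) /\ `|p v - p u| <= L * (v - u) &
      {ae @lebesgue_measure R, forall t, t0 <= t -> exists w : R,
         let a := A (q t) t in let b := B (q t) (p t) t in
         [/\ is_derive t 1 q (p t), is_derive t 1 p w, `|w - a| <= b &
             (w - a) * p t = - b * `|p t|]}].
Proof.
have [Q [P [Qc P0 QS PS]]] :=
  scheme_viable_sequences t0 c_gt0 contA contB B_ge0 A0_lt0 Ac_gt0.
have [F [UF ooF]] := @ultraFilterLemma nat \oo _.
have /choice[z Hz] : forall t, exists z : R * R, t0 <= t ->
    Q n (grid_index t0 n t) @[n --> F] --> z.1 /\
    P n (grid_index t0 n t) @[n --> F] --> z.2.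
  move=> t; have [t0t|tt0] := leP t0 t; last by exists (0, 0).
  have [w Hw] := scheme_ultralimit B_ge0 boundA Qc P0 PS UF t0t.
  by exists w.
pose q t := (z t).1; pose p t := (z t).2.
have cvgQ t : t0 <= t -> Q n (grid_index t0 n t) @[n --> F] --> q t by move=> /Hz[].
have cvgP t : t0 <= t -> P n (grid_index t0 n t) @[n --> F] --> p t by move=> /Hz[].
have qc := limit_q_bounds Qc UF cvgQ.
have lip := limit_lipschitz B_ge0 boundA boundB Qc P0 QS PS UF ooF cvgQ cvgP.
have dq t : t0 < t -> is_derive t 1 q (p t).
  move=> t0t; apply: (is_derive_of_increments t0t) => e e0.
  by apply: (limit_q_incr B_ge0 boundA boundB Qc P0 QS PS UF ooF cvgQ cvgP (ltW t0t)).
(* At an end, a nonzero speed would carry [q] out of [[0, c]] either just after or just before [t];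
   [move_to] takes the side [s] accordingly. *)
have qin t : t0 < t -> p t != 0 -> 0 < q t < c.
  move=> t0t pt0; have np0 : 0 < `|p t| by rewrite normr_gt0.
  have e0 : 0 < `|p t| / 2 by rewrite divr_gt0.
  have [d d0 Hd] := (is_deriveP q t (p t)).1 (dq t t0t) _ e0.
  pose r := Num.min d (t - t0) / 2.
  have m0 : 0 < Num.min d (t - t0) by rewrite lt_min d0 subr_gt0.
  have [m1 m2] : Num.min d (t - t0) <= d /\ Num.min d (t - t0) <= t - t0.
    by rewrite !ge_min !lexx orbT.
  have r0 : 0 < r by rewrite divr_gt0.
  have rd : r < d by rewrite /r; lra.
  have rt : r < t - t0 by rewrite /r; lra.
  have move_to (s : R) : `|s| = 1 ->
      `|q (t + r * s) - q t - r * (s * p t)| <= `|p t| / 2 * r /\ 0 <= q (t + r * s) <= c.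
    move=> s1; have nrs : `|r * s| = r by rewrite normrM s1 mulr1 gtr0_norm.
    split; first by have := Hd (r * s); rewrite nrs => /(_ rd); rewrite /GRing.scale /= -[r * s * _]mulrA.
    by apply: qc; have := ler_norm (- (r * s)); rewrite normrN nrs; lra.
  have sg1 : `|Num.sg (p t)| = 1 by rewrite normr_sg pt0.
  have rp : 0 < r * `|p t| by rewrite mulr_gt0.
  have /andP[q0 qc'] := qc t (ltW t0t).
  rewrite !lt_neqAle q0 qc' !andbT eq_sym; apply/andP; split; apply/eqP => qt.
    have [] := move_to (- Num.sg (p t)); first by rewrite normrN.
    by rewrite mulNr -normrEsg qt ler_norml => /andP[_ h] /andP[h' _]; lra.
  have [] := move_to (Num.sg (p t)) sg1.
  by rewrite -normrEsg qt ler_norml => /andP[h _] /andP[_ h']; lra.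
exists q, p; split=> //.
  exact: (limit_p_start P0 UF cvgP).
have lipp T : exists2 L : R, 0 < L & forall u v, t0 <= u -> u <= v -> v <= T ->
    `|p v - p u| <= L * (v - u).
  by have [L L0 HL] := lip T; exists L => // u v h1 h2 h3; case: (HL u v h1 h2 h3).
have nt0 : (@lebesgue_measure R).-negligible [set t0].
  apply/negligibleP; last exact: lebesgue_measure_set1.
  exact: measurable_set1.
apply: negligibleS (negligibleU (is_derive_zeros lipp) nt0) => t /=.
move=> nH; apply: contrapT => /not_orP[/contrapT Hz0 tt0]; apply: nH => t0t.
have {tt0}t0t' : t0 < t by rewrite lt_neqAle t0t andbT eq_sym; apply/eqP.
have [pt0|pt0] := eqVneq (p t) 0.
  exists 0; have dp := Hz0 t0t' pt0; split=> //; first exact: dq; last first.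
    by rewrite pt0 normr0 !mulr0.
  (* Over [[t, t + h]] the increment of [p] is at most [h * (e / 2)] because the derivative
     vanishes, and it differs from the drift times [h] by at most [(b + e / 2) * h]. *)
  rewrite sub0r normrN; apply/ler_addgt0Pr => e e0.
  have e20 : 0 < e / 2 by rewrite divr_gt0.
  have [d d0 Hd] := limit_p_incr contA contB B_ge0 boundA boundB Qc P0 QS PS
    UF ooF cvgQ cvgP t0t e20.
  have [d' d'0 Hd'] := (is_deriveP p t 0).1 dp _ e20.
  pose h := Num.min d d' / 2.
  have [m1 m2] : Num.min d d' <= d /\ Num.min d d' <= d' by rewrite !ge_min !lexx orbT.
  have h0 : 0 < h by rewrite divr_gt0// lt_min d0.
  have hd : h <= d by rewrite /h in h0 *; lra.
  have hd' : h < d' by rewrite /h in h0 *; lra.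
  have := Hd t (t + h) t0t; rewrite lerDl (ltW h0) subrr normr0 (ltW d0).
  rewrite addrAC subrr add0r (gtr0_norm h0) hd => /(_ isT isT isT).
  have := Hd' h; rewrite (gtr0_norm h0) hd' scaler0 subr0 => /(_ isT).
  rewrite pt0 subr0 => h1 h2.
  rewrite -(ler_pM2r h0).
  have -> : `|A (q t) t| * h = `|A (q t) t * h| by rewrite normrM (gtr0_norm h0).
  rewrite -[_ * h](subKr (p (t + h))) (le_trans (ler_normB _ _))//.
  lra.
exists (A (q t) t - B (q t) (p t) t * Num.sg (p t)); split.
- exact: dq.
- apply: (is_derive_of_increments t0t') => e e0.
  by apply: (limit_p_incr_sgn c_gt0 contA contB B_ge0 boundA boundB Qc P0 QS PS
    UF ooF cvgQ cvgP t0t e0 pt0 (qin t t0t' pt0)).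
- have -> : A (q t) t - B (q t) (p t) t * Num.sg (p t) - A (q t) t =
    - (B (q t) (p t) t * Num.sg (p t)) by ring.
  by rewrite normrN normrM normr_sg pt0 mulr1 ger0_norm// B_ge0.
- by rewrite [`|p t|]normrEsg; ring.
Qed.

End Viability.

(** * Application to the pendulum *)

Lemma abs_continuous_lipschitz (R : realType) (V : normedModType R) (a b L : R)
    (x : R -> V) : 0 < L ->
  (forall u v, a <= u -> u <= v -> v <= b -> `|x v - x u| <= L * (v - u)) ->
  abs_continuous a b x.
Proof.
move=> L0 H; apply: (abs_continuous_comp (x := fun=> 0 : R^o) L0).
  by move=> u v au uv vb; rewrite subrr normr0 add0r H.
move=> e e0; exists 1 => // n u v _ _ _.
by rewrite big1// => i _; rewrite subrr normr0.
Qed.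

Lemma lipschitz_segment_bounded (R : realType) (f : R -> R) (a : R) :
  lipschitz f ->
  forall b : R, exists C : R, forall t, a <= t <= b -> `|f t| <= C.
Proof.
move=> /lipschitzP[K K0 HK] b; exists (`|f a| + K * (b - a)) => t /andP[at' tb].
rewrite -[X in `|X|](subrKC (f a)).
rewrite (le_trans (ler_normD _ _))// lerD2l (le_trans (HK _ _))//.
by rewrite ler_pM2l// ger0_norm ?subr_ge0// lerB.
Qed.

Theorem proposition1 (R : realType) (l g mu : R)
    (l_gt0 : 0 < l) (g_gt0 : 0 < g) (mu_gt0 : 0 < mu)
    (xi : R -> R)
    (xi_derivable : forall t : R, derivable xi t 1)
    (xi'_derivable : forall t : R, derivable xi^`()%classic t 1)
    (xi''_lipschitz : lipschitz xi^`(2)%classic)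
    (t0 : R) :
  exists q0 p0 : R, 0 <= q0 <= pi /\
    exists x : R -> R^o * R^o,
      [/\ is_solution (pendulum_Phi l g mu xi) `[t0, +oo[ x,
          x t0 = (q0, p0),
          (forall y : R -> R^o * R^o,
             is_solution (pendulum_Phi l g mu xi) `[t0, +oo[ y ->
             y t0 = (q0, p0) ->
             forall t : R, t0 <= t -> y t = x t) &
          forall t : R, t0 < t -> 0 <= (x t).1 <= pi].
Proof.
set c := xi^`(2)%classic in xi''_lipschitz.
pose A q t := pendulum_drift l g (c t) q.
pose B q p t := pendulum_friction l g mu (c t) q p.
have cc : continuous c.
  have [K K0 HK] := lipschitzP xi''_lipschitz.
  move=> s; apply/cvgrPdist_le => e e0; apply/nbhs_ballP.
  exists (e / K) => /=; first by rewrite divr_gt0.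
  move=> u; rewrite /ball /= ltr_pdivlMr// => su.
  by rewrite (le_trans (HK _ _))// mulrC ltW.
have contA : continuous (fun z : R * R => A z.1 z.2).
  have c2 : continuous (fun z : R * R => c z.2).
    by apply: (@continuous_comp_fun _ _ _ snd c) => // z; exact: cvg_snd.
  by rewrite /A /pendulum_drift; continuity.
have contB : continuous (fun z : R * R * R => B z.1.1 z.1.2 z.2).
  have c2 : continuous (fun z : R * R * R => c z.2).
    by apply: (@continuous_comp_fun _ _ _ snd c) => // z; exact: cvg_snd.
  by rewrite /B /pendulum_friction; continuity.
have B0 q p t : 0 <= B q p t by exact: pendulum_friction_ge0.
have A0 t : A 0 t < 0.
  by rewrite /A /pendulum_drift sin0 cos0 mulr0 mulr1 sub0r oppr_lt0 divr_gt0.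
have Api t : 0 < A pi t.
  by rewrite /A /pendulum_drift sinpi cospi mulr0 mulrN1 opprK add0r divr_gt0.
have sin1 (q : R) : `|sin q| <= 1 by rewrite ler_norml sin_geN1 sin_le1.
have cos1 (q : R) : `|cos q| <= 1 by rewrite ler_norml cos_geN1 cos_le1.
have boundA T : exists M, forall q t, t0 <= t <= T -> `|A q t| <= M.
  have [C HC] := lipschitz_segment_bounded t0 xi''_lipschitz T.
  exists (C / l + g / l) => q t /HC ct.
  rewrite (le_trans (ler_normB _ _))// lerD// normrM.
    rewrite -[leRHS]mulr1 ler_pM// normrM normfV (gtr0_norm l_gt0).
    by rewrite ler_pM2r// invr_gt0.
  by rewrite gtr0_norm ?divr_gt0// -[leRHS]mulr1 ler_pM2l// divr_gt0.
have boundB T N : exists M, forall q p t, `|p| <= N -> t0 <= t <= T -> B q p t <= M.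
  have [C HC] := lipschitz_segment_bounded t0 xi''_lipschitz T.
  exists (mu / l * (C + l * N ^+ 2 + g)) => q p t pN /HC ct.
  rewrite /B /pendulum_friction ler_pM2l ?divr_gt0//.
  rewrite (le_trans (ler_normD _ _))// lerD//; last first.
    by rewrite normrM gtr0_norm// -[leRHS]mulr1 ler_pM2l.
  rewrite (le_trans (ler_normB _ _))// lerD// normrM.
    by rewrite -[leRHS]mulr1 ler_pM.
  rewrite gtr0_norm// ler_pM2l// normrX ler_sqr ?nnegrE//.
  exact: le_trans pN.
have [q [p [qpi p0 lip ae]]] :=
  dry_friction_viable (pi_gt0 R) contA contB B0 A0 Api boundA boundB.
(* The initial angle is the limit of the viable initial angles of the schemes, all started at
   rest. *)
exists (q t0), 0; split; first exact: qpi.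
pose x (t : R) : R^o * R^o := (q t, p t).
have xsol : is_solution (pendulum_Phi l g mu xi) `[t0, +oo[ x.
  split=> [a b|].
    rewrite !in_itv /= !andbT => t0a t0b; have [L L0 HL] := lip b.
    apply: (abs_continuous_lipschitz L0) => u v au uv vb.
    have [h1 h2] := HL u v (le_trans t0a au) uv vb.
    by rewrite prod_normE /= ge_max h1 h2.
  apply: negligibleS ae => t /=; apply: contra_not => H.
  rewrite in_itv /= andbT => /H[w [dq dp w1 w2]].
  exists (p t, w); first by apply/is_derive_pairP.
  by apply/(pendulum_PhiP g l_gt0 mu_gt0).
exists x; split=> //.
- by rewrite /x p0.
- move=> y ysol yt0 t t0t.
  apply: (pendulum_solution_unique l_gt0 g_gt0 mu_gt0 xi''_lipschitz ysol xsol) => //.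
  by rewrite yt0 /x p0.
- by move=> t /ltW; exact: qpi.
Qed.
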